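(* Let $\Omega\subseteq\mathbb R^n$ be a domain, let $p(\cdot),q(\cdot)\in\mathcal P(\Omega)$ satisfy $\frac1{p(\cdot)}-\frac1{q(\cdot)}=\frac{\alpha}{n}\in(0,1)$ with $\alpha$ constant, and let $W:\Omega\to\mathcal S_d$ be an invertible matrix weight. Then the operators $\mathcal A_{\alpha,Q}$ are bounded from $L^{p(\cdot)}(W,\Omega)$ to $L^{q(\cdot)}(W,\Omega)$ uniformly over all cubes $Q\subseteq\Omega$ if and only if $W\in\mathbb A_{p(\cdot),q(\cdot)}$. Moreover, there is a constant $C_d>0$ depending only on $d$ such that $$C_d^{-1}[W]_{\mathbb A_{p(\cdot),q(\cdot)}}\le\sup_{Q\subseteq\Omega}\|\mathcal A_{\alpha,Q}\|_{L^{p(\cdot)}(W,\Omega)\to L^{q(\cdot)}(W,\Omega)}\le4[W]_{\mathbb A_{p(\cdot),q(\cdot)}}.$$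
   Context: $\mathcal P(\Omega)$ is the set of measurable $p:\Omega\to[1,\infty)$ with $1<\operatorname{ess\,inf}_\Omega p\le\operatorname{ess\,sup}_\Omega p<\infty$; $p'(\cdot)=p(\cdot)/(p(\cdot)-1)$. For scalar $f$, $\|f\|_{L^{p(\cdot)}(\Omega)}=\inf\{\lambda>0:\int_\Omega(|f(x)|/\lambda)^{p(x)}dx\le1\}$. $\mathcal S_d$ is the set of $d\times d$ real self-adjoint positive semi-definite matrices. A matrix weight is a measurable $W:\Omega\to\mathcal S_d$ with $\|W\|\in L^1_{\mathrm{loc}}(\Omega)$, where $\|A\|=\sup_{|v|=1}|Av|$ is the operator norm; it is invertible if $W(x)$ is positive definite for a.e. $x$. $L^{p(\cdot)}(W,\Omega)$ is the space of measurable $\mathbf f:\Omega\to\mathbb R^d$ with $\|\mathbf f\|_{L^{p(\cdot)}(W,\Omega)}=\|\,|W\mathbf f|\,\|_{L^{p(\cdot)}(\Omega)}<\infty$. $W\in\mathbb A_{p(\cdot),q(\cdot)}$ means $$[W]_{\mathbb A_{p(\cdot),q(\cdot)}}:=\sup_{Q\subseteq\Omega}|Q|^{\frac\alpha n-1}\Big\|\,\big\|\,\|W^{-1}(y)W(x)\|\chi_Q(y)\big\|_{L^{p'(\cdot)}_y(\Omega)}\chi_Q(x)\Big\|_{L^{q(\cdot)}_x(\Omega)}<\infty,$$ the supremum over cubes $Q\subseteq\Omega$; the subscripts $x,y$ indicate the variable in which the norm is taken. $\mathcal A_{\alpha,Q}(\mathbf f)(x)=\Big(|Q|^{\frac\alpha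 n-1}\int_Q\mathbf f(y)\,dy\Big)\chi_Q(x)$. *)

(* Defs.v *)
From HB Require Import structures.
From mathcomp Require Import all_boot all_order all_algebra.
From mathcomp Require Import all_classical all_reals all_analysis.

Set Implicit Arguments.
Unset Strict Implicit.
Unset Printing Implicit Defensive.

Import Order.TTheory GRing.Theory Num.Theory.
Import numFieldNormedType.Exports.

Local Open Scope classical_set_scope.
Local Open Scope ring_scope.

Section lebesgue_outer_measure.
Context {R : realType} {n : nat}.
Local Notation Rn := 'rV[R]_n.+1.

(* The closed box [a_0, b_0] x ... x [a_n, b_n]; empty if b_i < a_i for
   some i. *)
Definition box (a b : Rn) : set Rn :=
  [set x | forall i, a 0 i <= x 0 i <= b 0 i].

Definition box_vol (a b : Rn) : R := \prod_i Num.max 0 (b 0 i - a 0 i).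

Definition box_cover (X : set Rn) : set (nat -> Rn * Rn) :=
  [set B | X `<=` \bigcup_k box (B k).1 (B k).2].

Definition lebesgue_outer (X : set Rn) : \bar R :=
  ereal_inf [set (\sum_(k <oo) (box_vol (B k).1 (B k).2)%:E)%E
            | B in box_cover X].

Lemma box_vol_ge0 a b : 0 <= box_vol a b.
Proof. by apply: prodr_ge0 => i _; rewrite le_max lexx. Qed.

Local Open Scope ereal_scope.

Let vol (c : Rn * Rn) : \bar R := (box_vol c.1 c.2)%:E.

Let vol_ge0 c : 0 <= vol c.
Proof. by rewrite lee_fin box_vol_ge0. Qed.

Lemma lebesgue_outer_ge0 X : 0 <= lebesgue_outer X.
Proof.
by apply: le_ereal_inf_tmp => x [B _ <-]; apply: nneseries_ge0 => k _ _;
  exact: (vol_ge0 (B k)).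
Qed.

Lemma lebesgue_outer0 : lebesgue_outer set0 = 0.
Proof.
apply/eqP; rewrite eq_le lebesgue_outer_ge0 andbT.
apply: ereal_inf_lbound; exists (fun=> (0%R, 0%R)) => //.
apply: eseries0 => k _ _ /=.
by rewrite /box_vol big_ord_recl !mxE subrr maxxx mul0r.
Qed.

Lemma le_lebesgue_outer : {homo lebesgue_outer : A B / A `<=` B >-> A <= B}.
Proof.
move=> A B AB; apply/ereal_inf_le_tmp => x [F BF <-].
by exists F => //; apply: subset_trans AB BF.
Qed.

Lemma lebesgue_outer_sigma_subadditive : sigma_subadditive lebesgue_outer.
Proof.
move=> A; have [[i ioo]|] := pselect (exists i, lebesgue_outer (A i) = +oo).
  rewrite (eseries_pinfty _ _ ioo) ?leey// => k _.
  by rewrite -ltNye (lt_le_trans _ (lebesgue_outer_ge0 _)).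
rewrite -forallNE => Aoo.
suff add2e (e : {posnum R}) : lebesgue_outer (\bigcup_n A n) <=
    \sum_(i <oo) lebesgue_outer (A i) + e%:num%:E.
  by apply/lee_addgt0Pr => _/posnumP[].
rewrite (le_trans _ (epsilon_trick _ _ _))//; last first.
  by move=> k; exact: lebesgue_outer_ge0.
pose P k (B : nat -> Rn * Rn) := box_cover (A k) B /\
  \sum_(j <oo) vol (B j) <= lebesgue_outer (A k) + (e%:num / (2 ^ k.+1)%:R)%:E.
have [G PG] : {G : nat -> nat -> Rn * Rn & forall k, P k (G k)}.
  apply: (@choice _ _ P) => k; rewrite /P /lebesgue_outer.
  set S := (X in ereal_inf X); move infS : (ereal_inf S) => iS.
  case: iS infS => [r Sr|Soo|Soo].
  - have en1 : (0 < e%:num / (2 ^ k.+1)%:R)%R by [].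
    have /(lb_ereal_inf_adherent en1) : ereal_inf S \is a fin_num by rewrite Sr.
    move=> [x [B AB xB] xS].
    by exists B; split => //; rewrite xB -Sr; exact/ltW.
  - by have := Aoo k; rewrite /lebesgue_outer Soo.
  - suff : lbound S 0 by move/le_ereal_inf_tmp; rewrite Soo.
    move=> /= _ [B AB <-].
    by apply: nneseries_ge0 => j _ _; exact: (vol_ge0 (B j)).
apply: (@le_trans _ _ (\esum_(i in setT) (vol \o uncurry G) i)).
  rewrite /lebesgue_outer; apply: ereal_inf_lbound => /=.
  have /card_esym/ppcard_eqP[f] := card_nat2.
  exists (uncurry G \o f).
    move=> t [i _ /(PG i).1 [j _ Bijt]]; exists (f^-1%FUN (i, j)) => //=.
    by rewrite invK ?inE.
  rewrite -(esum_pred_image (vol \o uncurry G) _ xpredT) ?[fun=> _]set_true//.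
    by rewrite image_eq.
  by move=> k _; exact: vol_ge0.
rewrite (_ : esum _ _ = \sum_(i <oo) \sum_(j <oo ) vol (G i j)); last first.
  pose J : nat -> set (nat * nat) := fun i => [set (i, j) | j in setT].
  rewrite (_ : setT = \bigcup_k J k); last first.
    by rewrite predeqE => -[a b]; split => // _; exists a => //; exists b.
  rewrite esum_bigcupT /=; last 2 first.
    - apply/trivIsetP => i j _ _ ij.
      rewrite predeqE => -[k m] /=; split => //= -[] [_] _ [<-{k} _].
      by move=> [m' _] [] /esym/eqP; rewrite (negbTE ij).
    - by move=> /= [k m]; exact: vol_ge0.
  rewrite -(image_id [set: nat]) -fun_true esum_pred_image//; last first.
    by move=> k _; apply: esum_ge0 => ? _; exact: vol_ge0.
  apply: eq_eseriesr => /= j _.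
  rewrite -(esum_pred_image (vol \o uncurry G) (pair j) predT)//=; last first.
    by move=> ? ? _ _; exact: (@can_inj _ _ _ snd).
  by congr esum; rewrite predeqE => -[a b]; split; move=> [i _ <-]; exists i.
apply: lee_lim.
- apply: is_cvg_nneseries => k *.
  by apply: nneseries_ge0 => m *; exact: vol_ge0.
- by apply: is_cvg_nneseries => k *; apply: adde_ge0 => //;
    exact: lebesgue_outer_ge0.
- by near=> k; apply: lee_sum => i _; exact: (PG i).2.
Unshelve. all: by end_near. Qed.

HB.instance Definition _ := isOuterMeasure.Build R Rn lebesgue_outer
  lebesgue_outer0 lebesgue_outer_ge0 le_lebesgue_outer
  lebesgue_outer_sigma_subadditive.

End lebesgue_outer_measure.

(* R^(n+1) with the sigma-algebra of Lebesgue (i.e. Caratheodory) measurable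
   sets. *)
Definition lebesgue_space (R : realType) (n : nat) :=
  caratheodory_type (@lebesgue_outer R n).
HB.instance Definition _ (R : realType) (n : nat) :=
  Measurable.on (lebesgue_space R n).

Definition lebesgue_mu (R : realType) (n : nat) :
  set (lebesgue_space R n) -> \bar R := @lebesgue_outer R n.
Arguments lebesgue_mu : clear implicits.
HB.instance Definition _ (R : realType) (n : nat) :=
  isMeasure.Build _ (lebesgue_space R n) R (lebesgue_mu R n)
    (@caratheodory_measure0 R _ _)
    (@caratheodory_measure_ge0 R _ _)
    (@caratheodory_measure_sigma_additive R _ _).

Section matrices.
Context {R : realType} {d : nat}.

Definition eucl_norm (v : 'cV[R]_d) : R := Num.sqrt (\sum_i v i 0 ^+ 2).

Definition op_norm (A : 'M[R]_d) : R :=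
  sup [set eucl_norm (A *m v) | v in [set v | eucl_norm v = 1]].

Definition psd_mx (A : 'M[R]_d) : Prop :=
  A^T = A /\ forall v : 'cV[R]_d, 0 <= (v^T *m A *m v) 0 0.

Definition pd_mx (A : 'M[R]_d) : Prop :=
  A^T = A /\ forall v : 'cV[R]_d, v != 0 -> 0 < (v^T *m A *m v) 0 0.

End matrices.

Section variable_lebesgue.
Context {dT : measure_display} {T : measurableType dT} {R : realType}.
Variable mu : {measure set T -> \bar R}.
Variable D : set T.

(* Essential bounds over D, as opposed to [ess_sup] and [ess_inf], which are
   taken over the whole of T. *)
Definition ess_sup_in (f : T -> R) : \bar R :=
  ereal_inf [set y | {ae mu, forall x, D x -> ((f x)%:E <= y)%E}].

Definition ess_inf_in (f : T -> R) : \bar R :=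
  ereal_sup [set y | {ae mu, forall x, D x -> (y <= (f x)%:E)%E}].

Definition exponent (p : T -> R) : Prop :=
  [/\ measurable_fun D p, forall x, D x -> 1 <= p x,
      (1%:E < ess_inf_in p)%E & (ess_sup_in p < +oo)%E].

Definition conj_exponent (p : T -> R) : T -> R := fun x => p x / (p x - 1).

(* The Luxemburg norm, for extended-real functions, since the iterated norm in
   the matrix A_{p,q} condition is applied to a function that may take the
   value +oo. *)
Definition Lvar_norm (p : T -> R) (f : T -> \bar R) : \bar R :=
  ereal_inf [set l%:E | l in [set l : R | 0 < l /\
    (\int[mu]_(x in D) ((`|f x| * (l^-1)%:E) `^ p x) <= 1)%E]].

Context {d : nat}.
Implicit Types (W : T -> 'M[R]_d) (f : T -> 'cV[R]_d).

Definition wLvar_norm (p : T -> R) W f : \bar R :=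
  Lvar_norm p (fun x => (eucl_norm (W x *m f x))%:E).

Definition wLvar (p : T -> R) W f : Prop :=
  (forall i, measurable_fun D (fun x => f x i 0)) /\
  (wLvar_norm p W f < +oo)%E.

End variable_lebesgue.

Section matrix_weights.
Context {R : realType} {n d : nat}.
Local Notation Rn := (lebesgue_space R n).
Local Notation mu := (lebesgue_mu R n).
Implicit Types (Omega Q : set 'rV[R]_n.+1) (p q : Rn -> R) (W : Rn -> 'M[R]_d).

Definition domain Omega : Prop :=
  [/\ Omega !=set0, open Omega & connected Omega].

Definition matrix_weight Omega W : Prop :=
  [/\ forall x, Omega x -> psd_mx (W x),
      forall i j, measurable_fun (Omega : set Rn) (fun x => W x i j) &
      forall K : set 'rV[R]_n.+1, compact K -> K `<=` Omega ->
        mu.-integrable (K : set Rn) (fun x => (op_norm (W x))%:E)].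

Definition invertible_weight Omega W : Prop :=
  {ae mu, forall x, Omega x -> pd_mx (W x)}.

(* Closed cubes with sides parallel to the coordinate axes. *)
Definition cubes_in Omega : set (set 'rV[R]_n.+1) :=
  [set Q | Q `<=` Omega /\ exists a l, 0 < l /\ Q = box a (a + const_mx l)].

Definition frac_coef (alpha : R) Q : R :=
  fine (mu Q) `^ (alpha / n.+1%:R - 1).

Definition frac_avg (alpha : R) Q (f : Rn -> 'cV[R]_d) : Rn -> 'cV[R]_d :=
  fun x => \1_Q x *: (frac_coef alpha Q *: \col_i \int[mu]_(y in Q) f y i 0).

(* The integrability clause says that the average is well defined on all of
   L^p(W); it is needed because the library integral is a total function. *)
Definition frac_avg_bound Omega (alpha : R) p q W Q (C : R) : Prop :=
  forall f, wLvar mu Omega p W f ->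
    [/\ forall i, mu.-integrable Q (fun y => (f y i 0)%:E),
        wLvar mu Omega q W (frac_avg alpha Q f) &
        (wLvar_norm mu Omega q W (frac_avg alpha Q f)
          <= C%:E * wLvar_norm mu Omega p W f)%E].

Definition frac_avg_norm Omega (alpha : R) p q W Q : \bar R :=
  ereal_inf [set C%:E | C in
    [set C : R | 0 <= C /\ frac_avg_bound Omega alpha p q W Q C]].

Definition Apq_const Omega (alpha : R) p q W : \bar R :=
  ereal_sup [set ((frac_coef alpha Q)%:E *
    Lvar_norm mu Omega q (fun x =>
      Lvar_norm mu Omega (conj_exponent p) (fun y =>
        (op_norm (invmx (W y) *m W x) * \1_Q y)%:E)
      * (\1_Q x)%:E))%E
  | Q in cubes_in Omega].

Definition Apq Omega (alpha : R) p q W : Prop :=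
  (Apq_const Omega alpha p q W < +oo)%E.

End matrix_weights.

(* Main.v *)
Require Import Defs.
From HB Require Import structures.
From mathcomp Require Import all_boot all_order all_algebra.
From mathcomp Require Import all_classical all_reals all_analysis.
From mathcomp Require Import perm measurable_realfun ring lra.

(* With N(x) the norm of ||W^-1(y) W(x)|| over y in Q, Hoelder's inequality gives
   |W(x) int_Q f| <= 2 N(x) ||W f||, which is the upper bound. For the lower
   bound, let K be the set of the averages int_Q f, for f in the unit ball of
   L^p(W). Testing with the (truncated) extremal functions of the norm conjugate
   formula shows that the L^p' norm of |W^-1 v| over Q is at most the supremum of
   |<v, u>| for u in K. The set K is bounded and spans R^d, so it contains
   u_1, ..., u_d, with almost maximal determinant, such that
   |<v, u>| <= 2 sum_j |<v, u_j>| for all u in K. Taking for v the columns of W(x)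
   bounds N(x) by a multiple of sum_j |W(x) u_j|, that is by the averages of d
   functions that do not depend on x. If Q is a null set, then all terms vanish,
   because 0 to a negative power is 0 in the library. *)

Set Implicit Arguments.
Unset Strict Implicit.
Unset Printing Implicit Defensive.

Import Order.TTheory GRing.Theory Num.Theory.
Import numFieldNormedType.Exports.

Local Open Scope classical_set_scope.
Local Open Scope ring_scope.

(** * Integrals without measurability, boxes *)

(** The function N takes values in [0, +oo] and is not shown to be measurable, so integrals that
    involve it are compared only through pointwise inequalities between the integrands. Norms are
    handled through modulars at levels strictly above them, so that it does not matter whether an
    infimum is attained.

    With a variable exponent no power of a constant comes out of a modular. Young's inequality is
    therefore used without the weights 1/p and 1/p', and this produces the 2 in Hoelder's
    inequality. The triangle inequality for d functions is replaced by a pointwise inequality that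
    costs d^2 whatever the exponent is. It is used twice, for the d columns of W(x) in the inner
    norm and for the d averages in the outer norm. Together with the 2 of the determinant argument
    this gives C_d = 2 d^4. That last 2 is there because K is not known to be closed, so a maximal
    determinant need not be attained. *)

Section lower_integral.
Context {dT : measure_display} {T : measurableType dT} {R : realType}.
Variable mu : {measure set T -> \bar R}.
Local Open Scope ereal_scope.

(* The library integral of a nonnegative function is the supremum of the
   integrals of the simple functions below it, so monotonicity needs no
   measurability. *)
Lemma ge0_le_integral_lower (D1 D2 : set T) (f g : T -> \bar R) :
  D1 `<=` D2 -> (forall x, D1 x -> 0 <= f x) -> (forall x, D2 x -> 0 <= g x) ->
  (forall x, D1 x -> f x <= g x) ->
  \int[mu]_(x in D1) f x <= \int[mu]_(x in D2) g x.
Proof.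
move=> D12 f0 g0 fg; rewrite !ge0_integralE//.
apply/ereal_sup_le => _ [h hf <-]; exists h => // x.
apply: (le_trans (hf x)); rewrite !patchE; case: ifPn => [|_].
  by rewrite inE => D1x; rewrite mem_set ?fg//; exact: D12.
by case: ifPn => //; rewrite inE; exact: g0.
Qed.

(** Extended by [+oo] on the null set [D \ A], [g] becomes a measurable majorant of [f] on all of
    [D], and the extension adds nothing to its integral. Only [g] has to be measurable. *)
Lemma le_integral_conull (D A : set T) (f g : T -> \bar R) :
  measurable D -> measurable A -> A `<=` D -> mu (D `\` A) = 0 ->
  (forall x, D x -> 0 <= f x) -> (forall x, A x -> f x <= g x) ->
  measurable_fun A g ->
  \int[mu]_(x in D) f x <= \int[mu]_(x in A) g x.
Proof.
move=> mD mA AD DA0 f0 fg mg.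
have g0 x : A x -> 0 <= g x.
  by move=> Ax; rewrite (le_trans _ (fg _ Ax))// f0//; exact: AD.
pose h x := if x \in A then g x else +oo.
have h0 x : 0 <= h x by rewrite /h; case: ifPn => //; rewrite inE; exact: g0.
have hA : {in A, h =1 g} by move=> x; rewrite /h => ->.
have mhA : measurable_fun A h.
  by apply: eq_measurable_fun mg => x xA; rewrite hA.
have mhD : measurable_fun (D `\` A) h.
  apply: eq_measurable_fun (measurable_cst +oo) => x; rewrite inE /h => -[_ Ax].
  by rewrite memNset.
rewrite (@le_trans _ _ (\int[mu]_(x in D) h x))//.
  apply: ge0_le_integral_lower => // x Dx.
  by rewrite /h; case: ifPn => [|_]; [rewrite inE; exact: fg|rewrite leey].
rewrite -(setDUK AD) ge0_integral_setU//; last 3 first.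
- exact: measurableD.
- by apply/measurable_funU => //; exact: measurableD.
- by apply/disj_setPS => x [Ax []].
rewrite (eq_integral _ _ hA) (null_set_integral _ mhD DA0) ?adde0//.
exact: measurableD.
Qed.

End lower_integral.

(** * Caratheodory measurability of boxes and open sets *)

Section box_measurability.
Context {R : realType} {n : nat}.
Local Notation Rn := 'rV[R]_n.+1.
Local Notation L := (lebesgue_space R n).
Local Notation mu := (lebesgue_mu R n).

Definition halfspace (i : 'I_n.+1) (c : R) : set Rn := [set x | x 0 i <= c].

Definition set_coord (a : Rn) (i : 'I_n.+1) (c : R) : Rn :=
  \row_j if j == i then c else a 0 j.

Lemma box_volE (a b : Rn) (i : 'I_n.+1) : box_vol a b =
  Num.max 0 (b 0 i - a 0 i) * \prod_(j | j != i) Num.max 0 (b 0 j - a 0 j).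
Proof. by rewrite /box_vol (bigD1 i). Qed.

(** The hyperplane x_i = c cuts the box in two. If it misses the box, or the box is empty, the
    truncation at 0 in [box_vol] keeps the identity true. *)
Lemma box_vol_split (a b : Rn) i c :
  box_vol a (set_coord b i (Num.min (b 0 i) c)) +
  box_vol (set_coord a i (Num.max (a 0 i) c)) b = box_vol a b.
Proof.
rewrite !(box_volE _ _ i) !mxE !eqxx.
rewrite [X in _ * X + _](eq_bigr (fun j => Num.max 0 (b 0 j - a 0 j))); last first.
  by move=> j ji; rewrite !mxE (negbTE ji).
rewrite [X in _ + _ * X](eq_bigr (fun j => Num.max 0 (b 0 j - a 0 j))); last first.
  by move=> j ji; rewrite !mxE (negbTE ji).
rewrite -mulrDl; congr (_ * _).
rewrite /Num.min /Num.max; do ! case: ifPn; rewrite -?leNgt => *; lra.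
Qed.

(** Cutting each box of a cover of [X] along the hyperplane gives covers of the two parts of [X]
    with the same total volume, which is the Caratheodory criterion. *)
Lemma halfspace_measurable i c : measurable (halfspace i c : set L).
Proof.
apply: le_caratheodory_measurable => X; apply: le_ereal_inf_tmp => _ [B XB <-].
pose B1 k := ((B k).1, set_coord (B k).2 i (Num.min ((B k).2 0 i) c)).
pose B2 k := (set_coord (B k).1 i (Num.max ((B k).1 0 i) c), (B k).2).
have bx (a b x : Rn) : box a b x <-> forall j, a 0 j <= x 0 j <= b 0 j by [].
rewrite (_ : (\sum_(k <oo) _)%E = (\sum_(k <oo) (box_vol (B1 k).1 (B1 k).2)%:E +
    \sum_(k <oo) (box_vol (B2 k).1 (B2 k).2)%:E)%E); last first.
  rewrite -nneseriesD; last 2 first.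
  - by move=> k _; rewrite lee_fin box_vol_ge0.
  - by move=> k _; rewrite lee_fin box_vol_ge0.
  by apply: eq_eseriesr => k _; rewrite -EFinD box_vol_split.
apply: leeD; apply: ereal_inf_lbound.
- exists B1 => // x [Xx Hx]; have [k _ Bx] := XB _ Xx; exists k => // j.
  have /andP[h1 h2] := Bx j; rewrite /B1/= !mxE h1/=.
  case: eqP => [ji|//]; rewrite ji in h2 *.
  by rewrite le_min h2 /=; exact: Hx.
- exists B2 => // x [Xx Hx]; have [k _ Bx] := XB _ Xx; exists k => // j.
  have /andP[h1 h2] := Bx j; rewrite /B2/= !mxE h2/= andbT.
  case: eqP => [ji|//]; rewrite ji in h1 *.
  by rewrite ge_max h1/= ltW// ltNge; apply/negP => /Hx.
Qed.

Lemma box_measurable (a b : Rn) : measurable (box a b : set L).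
Proof.
have oc i c : measurable ([set x : Rn | x 0 i < c] : set L).
  rewrite (_ : [set x : Rn | x 0 i < c] = \bigcup_k halfspace i (c - k.+1%:R^-1)).
    by apply: bigcupT_measurable => k; exact: halfspace_measurable.
  apply/seteqP; split => [x /= xc|x [k _] /= xk]; last first.
    by rewrite (le_lt_trans xk)// ltrBlDr ltrDl invr_gt0.
  have [k hk] := ltr_add_invr xc; exists k => //=.
  by rewrite /halfspace/= lerBrDr ltW.
rewrite (_ : box a b = \big[setI/setT]_(i < n.+1)
    (halfspace i (b 0 i) `&` ~` [set x | x 0 i < a 0 i])); last first.
  rewrite -bigcap_seq; apply/seteqP; split => [x bx i _|x bx i].
    have /andP[h1 h2] := bx i; split => //=; by rewrite ltNge h1.
  have [] := bx i _; first by rewrite /= mem_index_enum.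
  by rewrite /halfspace/= => -> /negP; rewrite -leNgt => ->.
apply: bigsetI_measurable => i _; apply: measurableI.
  exact: halfspace_measurable.
exact/measurableC/oc.
Qed.

(** [U] is the union of the boxes with rational corners that it contains. Balls are taken in the sup
    norm, so a small rational box around a point fits into a ball. The empty value of [F] lets the
    union run over all pairs of rational corners. *)
Lemma open_lebesgue_measurable (U : set Rn) : open U -> measurable (U : set L).
Proof.
move=> oU.
pose I := ('rV[rat]_n.+1 * 'rV[rat]_n.+1)%type.
pose F (ab : I) : set L := if `[< box (map_mx ratr ab.1) (map_mx ratr ab.2) `<=` U >]
  then box (map_mx ratr ab.1) (map_mx ratr ab.2) else set0.
rewrite (_ : U = \bigcup_ab F ab); last first.
  apply/seteqP; split => [x Ux|x [ab _]]; last first.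
    by rewrite /F; case: asboolP => // h; exact: h.
  have [e /= e0 eU] := (nbhs_ballP _ _).1 (open_nbhs_nbhs (conj oU Ux)).
  have hl i : exists r : rat, ratr r \in `](x 0 i - e), (x 0 i)[.
    by apply: rat_in_itvoo; rewrite ltrBlDr ltrDl.
  have hr i : exists r : rat, ratr r \in `](x 0 i), (x 0 i + e)[.
    by apply: rat_in_itvoo; rewrite ltrDl.
  have [fl Hl] := choice hl; have [fr Hr] := choice hr.
  exists (\row_i fl i, \row_i fr i) => //; rewrite /F; case: asboolP => /=.
    move=> _ i; rewrite !mxE.
    by have := Hl i; have := Hr i; rewrite !in_itv/= => /andP[/ltW-> _] /andP[_ /ltW->].
  case=> y hy; apply: eU; split => // i j; rewrite ord1.
  have := hy j; rewrite !mxE /ball/= ltr_norml.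
  have := Hl j; have := Hr j; rewrite !in_itv/= => /andP[? ?] /andP[? ?] /andP[? ?].
  by apply/andP; split; lra.
apply: countable_bigcupT_measurable; first exact: countableP.
by move=> ab; rewrite /F; case: asboolP => // _; exact: box_measurable.
Qed.

Lemma lebesgue_box_lty (a b : Rn) : (mu (box a b) < +oo)%E.
Proof.
apply: (@le_lt_trans _ _ (box_vol a b)%:E); last by rewrite ltry.
apply: ereal_inf_lbound.
exists (fun k => if k == 0%N then (a, b) else (0, 0)); first by move=> x bx; exists 0%N.
rewrite (@nneseriesD1 _ _ 0%N)//=; last by move=> k _; rewrite lee_fin box_vol_ge0.
rewrite eseries0 ?adde0// => k _ k0; rewrite (negbTE k0)/=.
by rewrite /box_vol big_ord_recl !mxE subrr maxxx mul0r.
Qed.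

End box_measurability.

(** * Linear algebra *)

Section euclidean.
Context {R : realType} {d : nat}.
Implicit Types (u v w : 'cV[R]_d) (A : 'M[R]_d).

Definition dot u v : R := \sum_i u i 0 * v i 0.

Lemma dotC u v : dot u v = dot v u.
Proof. by apply: eq_bigr => i _; rewrite mulrC. Qed.

Lemma dotZl a u v : dot (a *: u) v = a * dot u v.
Proof. by rewrite /dot mulr_sumr; apply: eq_bigr => i _; rewrite mxE mulrA. Qed.

Lemma dotZr a u v : dot u (a *: v) = a * dot u v.
Proof. by rewrite dotC dotZl dotC. Qed.

Lemma dot_suml I (r : seq I) (F : I -> 'cV[R]_d) v :
  dot (\sum_(i <- r) F i) v = \sum_(i <- r) dot (F i) v.
Proof.
rewrite /dot exchange_big/=; apply: eq_bigr => i _.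
by rewrite summxE mulr_suml.
Qed.

Lemma dot_delta u i : dot (delta_mx i 0) u = u i 0.
Proof.
rewrite /dot (bigD1 i)//= mxE !eqxx mul1r big1 ?addr0// => j ji.
by rewrite mxE (negbTE ji) mul0r.
Qed.

Lemma dot_mulmx A u v : dot u (A *m v) = dot (A^T *m u) v.
Proof.
rewrite /dot; under eq_bigr do rewrite mxE mulr_sumr.
rewrite exchange_big/=; apply: eq_bigr => i _.
by rewrite mxE mulr_suml; apply: eq_bigr => j _; rewrite mxE mulrCA mulrA.
Qed.

Lemma eucl_norm_ge0 v : 0 <= eucl_norm v.
Proof. exact: sqrtr_ge0. Qed.

Lemma sqr_eucl_norm v : eucl_norm v ^+ 2 = dot v v.
Proof.
rewrite sqr_sqrtr; first by apply: eq_bigr => i _; rewrite expr2.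
by apply: sumr_ge0 => i _; exact: sqr_ge0.
Qed.

Lemma eucl_normZ a v : eucl_norm (a *: v) = `|a| * eucl_norm v.
Proof.
apply/eqP; rewrite -(eqrXn2 (n := 2))//; last 2 first.
- exact: eucl_norm_ge0.
- by rewrite mulr_ge0// eucl_norm_ge0.
by rewrite exprMn !sqr_eucl_norm dotZl dotZr real_normK ?num_real// mulrA expr2.
Qed.

Lemma ler_coord_eucl_norm v i : `|v i 0| <= eucl_norm v.
Proof.
rewrite -(ler_pXn2r (n := 2))// ?nnegrE ?eucl_norm_ge0//.
rewrite sqr_eucl_norm real_normK ?num_real// /dot (bigD1 i)//= -expr2 lerDl.
by apply: sumr_ge0 => j _; rewrite -expr2 sqr_ge0.
Qed.

Lemma eucl_norm0 : eucl_norm (0 : 'cV[R]_d) = 0.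
Proof. by rewrite -(scale0r 0) eucl_normZ normr0 mul0r. Qed.

Lemma eucl_norm_eq0 v : (eucl_norm v == 0) = (v == 0).
Proof.
apply/eqP/eqP => [v0|->]; last exact: eucl_norm0.
by apply/colP => i; apply/eqP; rewrite mxE -normr_le0 -v0 ler_coord_eucl_norm.
Qed.

Lemma eucl_norm_gt0 v : (0 < eucl_norm v) = (v != 0).
Proof. by rewrite lt_def eucl_norm_ge0 andbT eucl_norm_eq0. Qed.

Lemma cauchy_schwarz u v : `|dot u v| <= eucl_norm u * eucl_norm v.
Proof.
have [->|u0] := eqVneq u 0.
  by rewrite -{1}(scale0r 0) dotZl mul0r normr0 mulr_ge0 ?eucl_norm_ge0.
have a0 : 0 < dot u u by rewrite -sqr_eucl_norm exprn_gt0// eucl_norm_gt0.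
rewrite -(ler_pXn2r (n := 2))// ?nnegrE ?mulr_ge0 ?eucl_norm_ge0//.
rewrite real_normK ?num_real// exprMn !sqr_eucl_norm.
(* This is the squared norm of <u,u> v - <u,v> u. *)
have : 0 <= \sum_i (dot u u * v i 0 - dot u v * u i 0) ^+ 2.
  by apply: sumr_ge0 => i _; exact: sqr_ge0.
rewrite (_ : \sum_i _ = dot u u * (dot u u * dot v v - dot u v ^+ 2)); last first.
  transitivity (\sum_i (dot u u ^+ 2 * (v i 0 * v i 0)
      - 2 * (dot u u * dot u v) * (u i 0 * v i 0) + dot u v ^+ 2 * (u i 0 * u i 0))).
    by apply: eq_bigr => i _; ring.
  rewrite big_split sumrB/= -!mulr_sumr -/(dot u u) -/(dot v v) -/(dot u v); ring.
by rewrite pmulr_rge0// subr_ge0.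
Qed.

(** Used to bound the norm of a vector-valued integral by means of scalar integrals. *)
Lemma eucl_norm_le_dual v c : (forall w, eucl_norm w <= 1 -> dot w v <= c) ->
  eucl_norm v <= c.
Proof.
move=> h; have [->|v0] := eqVneq v 0.
  have := h 0; rewrite eucl_norm0 ler01 => /(_ isT).
  by rewrite -{1}(scale0r 0) dotZl mul0r.
have n0 : eucl_norm v != 0 by rewrite eucl_norm_eq0.
have := h ((eucl_norm v)^-1 *: v).
rewrite eucl_normZ ger0_norm ?invr_ge0 ?eucl_norm_ge0// mulVf// lexx => /(_ isT).
by rewrite dotZl -sqr_eucl_norm expr2 mulrA mulVf// mul1r.
Qed.

Lemma mulmx_sum_col A v : A *m v = \sum_j v j 0 *: col j A.
Proof.
apply/colP => i; rewrite mxE summxE; apply: eq_bigr => j _.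
by rewrite !mxE mulrC.
Qed.

Lemma eucl_norm_mulmx A v :
  eucl_norm (A *m v) <= (\sum_j eucl_norm (col j A)) * eucl_norm v.
Proof.
apply: eucl_norm_le_dual => w w1.
rewrite mulmx_sum_col dotC dot_suml mulr_suml ler_sum// => j _.
rewrite dotZl mulrC (le_trans (ler_norm _))// normrM ler_pM//.
  rewrite (le_trans (cauchy_schwarz _ _))//.
  by rewrite -[leRHS]mulr1 ler_wpM2l// eucl_norm_ge0.
exact: ler_coord_eucl_norm.
Qed.

(** A real [sup] is an upper bound only for a set that is bounded above, so boundedness comes before
    any use of [op_norm]. *)
Lemma op_norm_ub A : ubound
  [set eucl_norm (A *m v) | v in [set v | eucl_norm v = 1]]
  (\sum_j eucl_norm (col j A)).
Proof. by move=> _ [v /= v1 <-]; rewrite (le_trans (eucl_norm_mulmx _ _))// v1 mulr1. Qed.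

Lemma eucl_norm_le_op_norm A v : eucl_norm (A *m v) <= op_norm A * eucl_norm v.
Proof.
have [->|v0] := eqVneq v 0; first by rewrite mulmx0 eucl_norm0 mulr0.
have n0 : eucl_norm v != 0 by rewrite eucl_norm_eq0.
rewrite -ler_pdivrMr ?lt_def ?n0 ?eucl_norm_ge0//.
rewrite mulrC -[X in X * _]ger0_norm ?invr_ge0 ?eucl_norm_ge0//.
rewrite -eucl_normZ scalemxAr; apply: ub_le_sup.
  by exists (\sum_j eucl_norm (col j A)); exact: op_norm_ub.
exists ((eucl_norm v)^-1 *: v) => //=.
by rewrite eucl_normZ ger0_norm ?invr_ge0 ?eucl_norm_ge0// mulVf.
Qed.

Lemma op_norm_le_sum A : op_norm A <= \sum_j eucl_norm (col j A).
Proof.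
rewrite /op_norm; set S := (X in sup X).
(* For d = 0 there is no unit vector, and the [sup] of the empty set is 0. *)
have [->|/set0P[x Sx]] := eqVneq S set0; last first.
  by apply: ge_sup; [exists x|exact: op_norm_ub].
by rewrite sup0 sumr_ge0// => j _; exact: eucl_norm_ge0.
Qed.

Lemma op_norm_ge0 A : 0 <= op_norm A.
Proof.
rewrite /op_norm; set S := (X in sup X).
have [->|/set0P[x [v v1 _]]] := eqVneq S set0; first by rewrite sup0.
apply: le_trans (eucl_norm_ge0 (A *m v)) _; apply: ub_le_sup; last by exists v.
by exists (\sum_j eucl_norm (col j A)); exact: op_norm_ub.
Qed.

Lemma pd_mx_unit A : pd_mx A -> A \in unitmx.
Proof.
case=> _ A0; rewrite -row_free_unit -kermx_eq0; apply/eqP/row_matrixP => i.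
rewrite row0; apply: contraTeq isT => v0.
have := A0 (row i (kermx A))^T; rewrite -trmx_eq0 in v0.
rewrite trmxK -row_mul mulmx_ker row0 mul0mx mxE ltxx.
by move=> /(_ v0).
Qed.

End euclidean.

(** * Bases of almost maximal determinant *)

Section near_auerbach_basis.
Context {R : realType} {d : nat}.
Variables (K : set 'cV[R]_d) (B : R).
Hypothesis K_bounded : forall u, K u -> forall i, `|u i 0| <= B.
Hypothesis K_spanning : forall v : 'cV[R]_d, v != 0 -> exists2 u, K u & dot v u != 0.

Let rows_in r (M : 'M[R]_(r, d)) := forall j, K (row j M)^T.

(** As long as fewer than d rows are chosen, some nonzero [v] is orthogonal to all of them. An
    element of [K] not orthogonal to [v] is then independent of these rows. *)
Lemma exists_row_free r : (r <= d)%N ->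
  exists2 M : 'M[R]_(r, d), rows_in M & row_free M.
Proof.
elim: r => [_|r IH rd].
  by exists 0 => [[]//|]; rewrite /row_free -leqn0 rank_leq_row.
have [M KM fM] := IH (ltnW rd).
have : kermx M^T != 0.
  by rewrite -mxrank_eq0 mxrank_ker mxrank_tr (eqP fM) subn_eq0 -ltnNge.
case/rowV0Pn => v /sub_kermxP vM v0.
have [|u Ku vu] := K_spanning (v := v^T); first by rewrite trmx_eq0.
exists (col_mx u^T M) => [j|].
  case: (@split_ordP 1 r j) => k ->.
    suff : K (row (lshift r k) (col_mx u^T M))^T by [].
    by rewrite rowKu ord1 row_id trmxK.
  suff : K (row (rshift 1 k) (col_mx u^T M))^T by [].
  by rewrite rowKd.
rewrite -kermx_eq0; apply/rowV0P => w /sub_kermxP.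
rewrite -[w](@hsubmxK _ 1 1 r) (@mul_row_col _ 1 1 r d).
set a := lsubmx _; set b := rsubmx _ => ab0.
have Mv : M *m v^T = 0 by rewrite -[M]trmxK -trmx_mul vM trmx0.
(* Pairing a linear relation with [v] kills the old rows and isolates the coefficient [a] of the new
   one. *)
have au : a *m (u^T *m v^T) = 0.
  have := congr1 (mulmx^~ v^T) ab0; rewrite mul0mx mulmxDl -!mulmxA.
  by rewrite Mv mulmx0 addr0.
have a0 : a = 0.
  apply/rowP => i; rewrite ord1 [RHS]mxE; apply: (mulIf vu); rewrite mul0r.
  have := congr1 (fun X : 'M[R]_1 => X 0 0) au; rewrite mxE big_ord1 [RHS]mxE.
  move=> h; rewrite -[RHS]h; congr (_ * _); rewrite [RHS]mxE.
  by apply: eq_bigr => k _; rewrite !mxE mulrC.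
move: ab0; rewrite a0 mul0mx add0r => bM.
suff -> : b = 0 by rewrite row_mx0.
have /rowV0P kM : kermx M == 0 by rewrite kermx_eq0.
by apply: kM; apply/sub_kermxP.
Qed.

(* Cramer's rule bounds the coordinates of [u] by ratios of determinants, which
   are at most 2 for a basis whose determinant is within a factor 2 of the
   supremum. *)
Lemma exists_near_auerbach_basis : exists2 U : 'I_d -> 'cV[R]_d,
  (forall j, K (U j)) &
  forall u v, K u -> `|dot v u| <= 2 * \sum_j `|dot v (U j)|.
Proof.
pose S : set R := [set `|\det M| | M in [set M : 'M[R]_d | rows_in M]].
have [M0 KM0 fM0] := exists_row_free (leqnn d).
have S_ub : has_ubound S.
  (* In the Leibniz expansion each product of entries is at most B^d in absolute value. *)
  exists (\sum_(s : 'S_d) B ^+ d) => _ [M KM <-].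
  rewrite (le_trans (ler_norm_sum _ _ _))// ler_sum// => s _.
  rewrite normrM normrX normrN1 expr1n mul1r normr_prod.
  rewrite -[X in B ^+ X]card_ord -prodr_const ler_prod// => i _.
  by rewrite normr_ge0/=; have := K_bounded (KM i) (s i); rewrite !mxE.
have S_gt0 : 0 < sup S.
  apply: (@lt_le_trans _ _ `|\det M0|).
    by rewrite normr_gt0 -unitfE -unitmxE -row_free_unit.
  by apply: ub_le_sup => //; exists M0.
have S_sup : has_sup S by split => //; exists `|\det M0|; exists M0.
have [|_ [M KM <-] ltM] := sup_adherent _ S_sup (eps := sup S / 2).
  by rewrite divr_gt0.
have M_neq0 : \det M != 0.
  by rewrite -normr_gt0 (lt_trans _ ltM)//; lra.
exists (fun j => (row j M)^T) => // u v Ku.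
pose c := u^T *m invmx M.
have c2 j : `|c 0 j| <= 2.
  (* [M] with row [j] replaced by [u]. Its rows lie in [K] too, so its determinant is bounded by the
     same supremum. *)
  pose Mj := \matrix_i (if i == j then u^T else row i M).
  have -> : c 0 j = \det Mj / \det M.
    rewrite /c /invmx unitmxE unitfE M_neq0 -scalemxAr mxE mulrC; congr (_ / _).
    rewrite mxE (expand_det_row _ j); apply: eq_bigr => k _.
    rewrite !mxE eqxx !mxE; congr (_ * (_ * \det _)).
    apply/matrixP => a b; rewrite !mxE; case: eqP => [/eqP|_]; last by rewrite mxE.
    by rewrite eq_sym (negbTE (neq_lift _ _)).
  rewrite normrM normfV ler_pdivrMr ?normr_gt0//.
  apply: (@le_trans _ _ (sup S)); last by lra.
  apply: ub_le_sup => //; exists Mj => // i.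
  rewrite (_ : row i Mj = if i == j then u^T else row i M); last first.
    by apply/rowP => k; rewrite !mxE.
  by case: ifP => _; rewrite ?trmxK.
have uE : u = \sum_j c 0 j *: (row j M)^T.
  have Mu : M \in unitmx by rewrite unitmxE unitfE.
  apply: trmx_inj; rewrite -[LHS](mulmxKV Mu) -/c.
  rewrite mulmx_sum_row raddf_sum; apply: eq_bigr => j _ /=.
  by rewrite linearZ/= trmxK.
rewrite {1}uE dotC dot_suml mulr_sumr (le_trans (ler_norm_sum _ _ _))//.
by apply: ler_sum => j _; rewrite dotZl normrM dotC ler_wpM2r.
Qed.

End near_auerbach_basis.

(** * Measurability *)

Section measurability.
Context {dT : measure_display} {T : measurableType dT} {R : realType}.
Variable D : set T.

Lemma measurable_fun_powR2 (f g : T -> R) : measurable_fun D f ->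
  measurable_fun D g -> measurable_fun D (fun x => f x `^ g x).
Proof.
move=> mf mg mD; move: (mD); rewrite /powR.
have m0 (h : T -> R) : measurable_fun D h -> measurable_fun D (fun x => h x == 0).
  by move=> mh; exact: measurable_fun_eqr.
rewrite (_ : (fun _ => _) = (fun x => if f x == 0 then if g x == 0 then 1 else 0
    else expR (g x * ln (f x)))); last first.
  by apply/funext => x; case: ifP => // _; case: ifP.
apply: measurable_fun_if => //; first exact: m0.
  apply: (measurable_funS mD); first by move=> x [].
  by apply: measurable_fun_if => //; exact: m0.
apply: (measurable_funS mD); first by move=> x [].
apply: measurableT_comp => //; apply: measurable_funM => //.
exact: measurableT_comp.
Qed.

(** The square makes the base nonnegative, where the power -1 is the inverse. Where [f] vanishes,
    both sides are 0. *)
Lemma measurable_fun_invr (f : T -> R) : measurable_fun D f ->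
  measurable_fun D (fun x => (f x)^-1).
Proof.
move=> mf; rewrite (_ : (fun _ => _) = (fun x => f x * (f x ^+ 2) `^ (-1))).
  apply: measurable_funM => //.
  apply: (measurableT_comp (measurable_powR (-1))).
  exact: measurable_funX.
apply/funext => x; rewrite powR_inv1 ?sqr_ge0//.
have [->|fx0] := eqVneq (f x) 0; first by rewrite invr0 mul0r.
by rewrite expr2 invfM mulrA mulfV// mul1r.
Qed.

Variable d : nat.

Lemma measurable_dot (f g : T -> 'cV[R]_d) :
  (forall i, measurable_fun D (fun x => f x i 0)) ->
  (forall i, measurable_fun D (fun x => g x i 0)) ->
  measurable_fun D (fun x => dot (f x) (g x)).
Proof.
by move=> mf mg; apply: measurable_sum => i; exact: measurable_funM.
Qed.

Lemma measurable_eucl_norm (f : T -> 'cV[R]_d) :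
  (forall i, measurable_fun D (fun x => f x i 0)) ->
  measurable_fun D (fun x => eucl_norm (f x)).
Proof.
move=> mf; rewrite (_ : (fun _ => _) = (fun x => dot (f x) (f x) `^ (2^-1))).
  by apply: (measurableT_comp (measurable_powR _)); exact: measurable_dot.
apply/funext => x; rewrite powR12_sqrt.
  by rewrite -sqr_eucl_norm sqrtr_sqr ger0_norm// eucl_norm_ge0.
by rewrite -sqr_eucl_norm sqr_ge0.
Qed.

Lemma measurable_mulmx m (A : T -> 'M[R]_d) (f : T -> 'M[R]_(d, m)) :
  (forall i j, measurable_fun D (fun x => A x i j)) ->
  (forall i j, measurable_fun D (fun x => f x i j)) ->
  forall i j, measurable_fun D (fun x => (A x *m f x) i j).
Proof.
move=> mA mf i j; under eq_fun do rewrite mxE.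
by apply: measurable_sum => k; exact: measurable_funM.
Qed.

Lemma measurable_det k (A : T -> 'M[R]_k) :
  (forall i j, measurable_fun D (fun x => A x i j)) ->
  measurable_fun D (fun x => \det (A x)).
Proof.
move=> mA; apply: measurable_sum => s; apply: measurable_funM => //.
by apply: measurable_prod => i _.
Qed.

Lemma measurable_unitmx (A : T -> 'M[R]_d) : measurable D ->
  (forall i j, measurable_fun D (fun x => A x i j)) ->
  measurable (D `&` [set x | A x \in unitmx]).
Proof.
move=> mD mA; rewrite (_ : _ `&` _ = D `&` (fun x => \det (A x)) @^-1` ~` [set 0]).
  by apply: measurable_det => //; exact: measurableC.
by apply/seteqP; split => x /= [Dx]; rewrite unitmxE unitfE => /eqP.
Qed.

(** The adjugate formula gives the inverse only on the invertible matrices; elsewhere [invmx]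
    returns its argument. *)
Lemma measurable_invmx (A : T -> 'M[R]_d) : measurable D ->
  (forall i j, measurable_fun D (fun x => A x i j)) ->
  forall i j,
  measurable_fun (D `&` [set x | A x \in unitmx]) (fun x => invmx (A x) i j).
Proof.
move=> mD mA i j; have mU := measurable_unitmx mD mA.
apply: (@eq_measurable_fun _ _ _ _ _
    (fun x => (\det (A x))^-1 * cofactor (A x) j i)).
  by move=> x; rewrite inE /= => -[_ Ax]; rewrite /invmx Ax !mxE.
apply: (measurable_funS mD); first by move=> x [].
apply: measurable_funM; first by apply: measurable_fun_invr; exact: measurable_det.
apply: measurable_funM => //; apply: measurable_det => a b.
rewrite (_ : (fun _ => _) = (fun x => A x (lift j a) (lift i b)))//.
by apply/funext => x; rewrite !mxE.
Qed.

End measurability.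

(** * Modulars *)

Section real_inequalities.
Context {R : realType}.

Lemma conj_exponent_ge1 (p : R) : 1 < p -> 1 <= p / (p - 1).
Proof. by move=> p1; rewrite ler_pdivlMr ?subr_gt0// mul1r gerBl. Qed.

(** The weights 1/p and 1/p' of Young's inequality would depend on the point; bounding them by 1
    leaves two plain modulars. *)
Lemma young_powR (p u v : R) : 1 < p -> 0 <= u -> 0 <= v ->
  u * v <= u `^ (p / (p - 1)) + v `^ p.
Proof.
move=> p1 u0 v0; have p10 : 0 < p - 1 by rewrite subr_gt0.
have q1 := conj_exponent_ge1 p1.
apply: (@le_trans _ _ (u `^ (p / (p - 1)) / (p / (p - 1)) + v `^ p / p)).
  apply: conjugate_powR => //; [lra|lra|].
  by field; apply/andP; split; lra.
by apply: lerD; rewrite ler_piMr ?powR_ge0// invf_le1//; lra.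
Qed.

(** One factor 1/d turns the sum into a mean, which is at most the largest term. The other comes out
    of the power because d^-r <= d^-1 for r >= 1. The constant is thus independent of [r], as a
    variable exponent requires. *)
Lemma powR_mean_le d (t : 'I_d -> R) (r : R) : (0 < d)%N -> 1 <= r ->
  (forall j, 0 <= t j) ->
  ((d%:R ^+ 2)^-1 * \sum_j t j) `^ r <= d%:R^-1 * \sum_j t j `^ r.
Proof.
case: d t => // d t _ r1 t0.
have [j0 _ tj0] := @arg_maxP _ _ _ (ord0 : 'I_d.+1) xpredT t isT.
have d0 : 0 < d.+1%:R :> R by rewrite ltr0n.
have r0 : 0 <= r by lra.
have s0 : 0 <= \sum_j t j by exact: sumr_ge0.
rewrite expr2 invfM -mulrA.
apply: (@le_trans _ _ (d.+1%:R^-1 * (d.+1%:R^-1 * \sum_j t j) `^ r)).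
  apply: ge1r_powRZ => //; last by rewrite mulr_ge0// invr_ge0 ltW.
  by rewrite invr_gt0 d0/= invf_le1// ler1n.
rewrite ler_pM2l ?invr_gt0//.
apply: (@le_trans _ _ (t j0 `^ r)).
  apply: ge0_ler_powR; rewrite ?nnegrE//.
    by rewrite mulr_ge0// invr_ge0 ltW.
  rewrite mulrC ler_pdivrMr// mulr_natr -[d.+1 in leRHS]card_ord -sumr_const.
  by apply: ler_sum => j _; exact: tj0.
rewrite (bigD1 j0)//= lerDl; apply: sumr_ge0 => j _; exact: powR_ge0.
Qed.

End real_inequalities.

Section modular.
Context {dT : measure_display} {T : measurableType dT} {R : realType}.
Variable mu : {measure set T -> \bar R}.
Variable D : set T.
Implicit Types (p : T -> R) (f g : T -> \bar R).
Local Open Scope ereal_scope.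

(** The integral in the definition of [Lvar_norm], at level [l]. *)
Definition modular p f (l : R) : \bar R :=
  \int[mu]_(x in D) ((`|f x| * (l^-1)%:E) `^ p x).

Lemma modular_integrandE (a l r : R) : (0 <= a)%R ->
  (`|a%:E| * (l^-1)%:E) `^ r = ((a / l) `^ r)%:E.
Proof. by move=> a0; rewrite gee0_abs ?lee_fin// -EFinM poweR_EFin. Qed.

Lemma le_modular p f g (l l' : R) : (forall x, D x -> (0 <= p x)%R) ->
  (0 < l)%R -> (l <= l')%R -> (forall x, D x -> `|g x| <= `|f x|) ->
  modular p g l' <= modular p f l.
Proof.
move=> p0 l0 ll' gf; apply: ge0_le_integral_lower => // [x _|x _|x Dx].
- exact: poweR_ge0.
- exact: poweR_ge0.
have l'0 : (0 < l')%R by exact: lt_le_trans ll'.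
have i0 : (0 <= l'^-1)%R by rewrite invr_ge0 ltW.
apply: gt0_ler_poweR; rewrite ?in_itv/= ?leey ?andbT ?p0//.
- by rewrite mule_ge0// ?lee_fin.
- by rewrite mule_ge0// ?lee_fin ?invr_ge0 ?ltW.
by rewrite lee_pmul ?lee_fin ?lef_pV2// gf.
Qed.

Lemma Lvar_norm_ge0 p f : 0 <= Lvar_norm mu D p f.
Proof. by apply: le_ereal_inf_tmp => _ [l [l0 _] <-]; rewrite lee_fin ltW. Qed.

Lemma Lvar_norm_le p f (l : R) : (0 < l)%R -> modular p f l <= 1 ->
  Lvar_norm mu D p f <= l%:E.
Proof. by move=> l0 h; apply: ereal_inf_lbound; exists l. Qed.

Lemma Lvar_norm_lt p f y : Lvar_norm mu D p f < y ->
  exists l : R, [/\ (0 < l)%R, modular p f l <= 1 & l%:E < y].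
Proof. by move=> /ereal_inf_lt[_ [l [l0 h] <-]] ly; exists l. Qed.

Lemma modular_gt_Lvar_norm p f (l : R) : (forall x, D x -> (0 <= p x)%R) ->
  Lvar_norm mu D p f < l%:E -> modular p f l <= 1.
Proof.
move=> p0 /Lvar_norm_lt[l' [l'0 h l'l]]; apply: le_trans h.
by apply: le_modular => //; rewrite ltW// -lte_fin.
Qed.

End modular.

(** On a subset of positive measure [m], [h] is at least 1/(k+1). If [l] is smaller than that, then
    h/l >= 1 there, and raising it to a power r >= 1 only increases it; so m / ((k+1) l) <= 1. Hence
    [delta] depends neither on [r] nor on [l]. *)
Lemma modular_lower_bound (dT : measure_display) (T : measurableType dT)
    (R : realType) (mu : {measure set T -> \bar R}) (A : set T) (h : T -> R) :
  measurable A -> (0 < mu A < +oo)%E -> measurable_fun A h ->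
  (forall x, A x -> 0 < h x) ->
  exists2 delta : R, 0 < delta & forall (l : R) (r : T -> R), 0 < l ->
    (forall x, A x -> 1 <= r x) ->
    (\int[mu]_(x in A) ((h x / l) `^ r x)%:E <= 1)%E -> delta <= l.
Proof.
move=> mA /andP[A0 Aoo] mh h0.
pose Ak k := A `&` [set x | k.+1%:R^-1 <= h x].
have mAk k : measurable (Ak k).
  rewrite (_ : Ak k = A `&` h @^-1` `[k.+1%:R^-1, +oo[).
    by apply: mh => //; exact: measurable_itv.
  by apply/seteqP; split => x; rewrite /Ak/= in_itv/= andbT.
have [k muAk] : exists k, (0 < mu (Ak k))%E.
  apply: contrapT => /forallNP hk.
  suff : mu A = 0%E by move=> A00; rewrite A00 ltxx in A0.
  have AE : A = \bigcup_k Ak k.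
    apply/seteqP; split => [x Ax|x [k _ []]//].
    have [k hk'] := ltr_add_invr (h0 x Ax).
    by exists k => //; split => //=; rewrite add0r in hk'; exact: ltW.
  have nk k : mu.-negligible (Ak k).
    apply/negligibleP => //; apply/eqP; rewrite eq_le measure_ge0 andbT leNgt.
    by apply/negP; exact: hk.
  have := negligible_bigcup nk; rewrite -AE.
  by move=> /negligibleP; exact.
have mAkoo : (mu (Ak k) < +oo)%E.
  by apply: le_lt_trans Aoo; apply: le_measure; rewrite ?inE// => x [].
have mE : mu (Ak k) = (fine (mu (Ak k)))%:E by rewrite fineK// ge0_fin_numE.
set m := fine _ in mE; have m0 : 0 < m by rewrite -lte_fin -mE.
have k0 : 0 < k.+1%:R^-1 :> R by rewrite invr_gt0.
exists (Num.min k.+1%:R^-1 (m / k.+1%:R)) => [|l r l0 r1 h1].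
  by rewrite lt_min k0/= divr_gt0.
rewrite ge_min; have [//|lk/=] := leP k.+1%:R^-1 l.
suff : ((k.+1%:R^-1 / l)%:E * mu (Ak k) <= 1)%E.
  by rewrite mE -EFinM lee_fin mulrAC ler_pdivrMr// mul1r mulrC.
apply: le_trans h1; rewrite -[leLHS]integral_cst//.
apply: ge0_le_integral_lower => [x []//|x _|x _|x [Ax hx]].
- by rewrite lee_fin divr_ge0// ltW.
- by rewrite lee_fin powR_ge0.
rewrite lee_fin (@le_trans _ _ (h x / l))// ?ler_pM2r ?invr_gt0//.
apply: le1r_powR; last exact: r1.
by rewrite ler_pdivlMr// mul1r (le_trans (ltW lk)).
Qed.

(** * Weighted averages *)

Section weighted_averages.
Context {dT : measure_display} {T : measurableType dT} {R : realType} {d : nat}.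
Variable mu : {measure set T -> \bar R}.
Variables (D Q : set T) (W : T -> 'M[R]_d) (p : T -> R).
Hypothesis mD : measurable D.
Hypothesis mQ : measurable Q.
Hypothesis QD : Q `<=` D.
Hypothesis mW : forall i j, measurable_fun D (fun x => W x i j).
Hypothesis symW : forall x, D x -> (W x)^T = W x.
Hypothesis mp : measurable_fun D p.
Hypothesis p_ge1 : forall x, D x -> 1 <= p x.

(** Outside this set [invmx] or [conj_exponent] takes a default value. It is measurable and conull,
    so integrals can be restricted to it. *)
Definition regular_points : set T :=
  D `&` [set x | W x \in unitmx] `&` [set x | 1 < p x].
Local Notation G := regular_points.

Hypothesis G_conull : mu (D `\` G) = 0%E.

Lemma regular_points_sub : G `<=` D. Proof. by move=> x [[]]. Qed.

Lemma measurable_regular_points : measurable G.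
Proof.
have -> : G = (D `&` [set x | W x \in unitmx]) `&` (D `&` p @^-1` `]1, +oo[).
  by apply/seteqP; split => x; rewrite /G/= in_itv/= andbT; tauto.
apply: measurableI; first exact: measurable_unitmx.
by apply: mp => //; exact: measurable_itv.
Qed.
Let mG := measurable_regular_points.

Let mQG : measurable (Q `&` G). Proof. exact: measurableI. Qed.

Let QG_sub : Q `&` G `<=` D. Proof. by move=> x [/QD]. Qed.

Lemma regular_points_conull : mu (Q `\` (Q `&` G)) = 0%E.
Proof.
apply/eqP; rewrite eq_le measure_ge0 andbT -G_conull le_measure ?inE//.
- exact: measurableD.
- exact: measurableD.
- by move=> x [Qx nx]; split; [exact: QD|move=> Gx; apply: nx].
Qed.

Lemma measure_regular_points : mu (Q `&` G) = mu Q.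
Proof.
have {2}-> : Q = (Q `&` G) `|` (Q `\` (Q `&` G)).
  by rewrite setDUK// => x [].
have mQ' : measurable (Q `\` (Q `&` G)) by exact: measurableD.
rewrite measureU//; last by rewrite setDIK.
by rewrite [X in (_ + X)%E]regular_points_conull adde0.
Qed.

Lemma regular_conj_exponent_ge1 x : G x -> 1 <= conj_exponent p x.
Proof. by case=> _ px; exact: conj_exponent_ge1. Qed.

(** This covers p = 1, where division by zero gives the value 0. Monotonicity of modulars needs
    nonnegative exponents on all of [D]. *)
Lemma conj_exponent_ge0 x : D x -> 0 <= conj_exponent p x.
Proof.
move=> Dx; have := p_ge1 Dx => px.
by rewrite divr_ge0// ?subr_ge0// (le_trans ler01).
Qed.

Lemma measurable_conj_exponent : measurable_fun (Q `&` G) (conj_exponent p).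
Proof.
apply: (measurable_funS mD) => //; apply: measurable_funM => //.
by apply: measurable_fun_invr; apply: measurable_funB.
Qed.

Lemma measurable_invW_mulmx (m : nat) (v : 'M[R]_(d, m)) i j :
  measurable_fun (Q `&` G) (fun y => (invmx (W y) *m v) i j).
Proof.
apply: measurable_mulmx => // a b.
apply: (measurable_funS (measurable_unitmx mD mW)).
  by move=> x [_ []].
exact: measurable_invmx.
Qed.

Lemma invW_sym x : D x -> (invmx (W x))^T = invmx (W x).
Proof. by move=> Dx; rewrite trmx_inv symW. Qed.

Lemma measurable_W_mulmx (f : T -> 'cV[R]_d) :
  (forall i, measurable_fun D (fun x => f x i 0)) ->
  forall i j, measurable_fun D (fun y => (W y *m f y) i j).
Proof. by move=> mf; apply: measurable_mulmx => // i j; rewrite ord1. Qed.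

Definition opW x y : \bar R := (op_norm (invmx (W y) *m W x) * \1_Q y)%:E.

(** By symmetry of W, <W(x) w, f(y)> = <W(y)^-1 W(x) w, W(y) f(y)>. Cauchy-Schwarz and Young apply
    after scaling the two factors by r l and m. The free vector [w] serves two purposes: W(x)^-1 e_i
    gives integrability of a coordinate, and |w| <= 1 gives the norm of the average. *)
Lemma hoelder_weight (x : T) (f : T -> 'cV[R]_d) (w : 'cV[R]_d) (l m r : R) :
  (forall i, measurable_fun D (fun x => f x i 0)) ->
  0 < l -> 0 < m -> 0 < r -> eucl_norm w <= r ->
  (modular mu D (conj_exponent p) (opW x) l <= 1)%E ->
  (modular mu D p (fun y => (eucl_norm (W y *m f y))%:E) m <= 1)%E ->
  (\int[mu]_(y in Q) `|(dot (W x *m w) (f y))%:E| <= (2 * l * m * r)%:E)%E.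
Proof.
move=> mf l0 m0 r0 wr modl modm.
pose u y := eucl_norm (invmx (W y) *m (W x *m w)) / (r * l).
pose v y := eucl_norm (W y *m f y) / m.
have u0 y : 0 <= u y by rewrite divr_ge0 ?eucl_norm_ge0// mulr_ge0 ?ltW.
have v0 y : 0 <= v y by rewrite divr_ge0 ?eucl_norm_ge0// ltW.
have mu' : measurable_fun (Q `&` G) (fun y => u y `^ conj_exponent p y).
  apply: measurable_fun_powR2; last exact: measurable_conj_exponent.
  apply: measurable_funM => //; apply: measurable_eucl_norm => i.
  exact: measurable_invW_mulmx.
have mv' : measurable_fun (Q `&` G) (fun y => v y `^ p y).
  apply: (measurable_funS mD) => //; apply: measurable_fun_powR2 => //.
  apply: measurable_funM => //; apply: measurable_eucl_norm => i.
  exact: measurable_W_mulmx.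
have lmr0 : 0 <= l * m * r by rewrite !mulr_ge0 ?ltW.
apply: (@le_trans _ _ (\int[mu]_(y in Q `&` G)
    ((l * m * r)%:E * ((u y `^ conj_exponent p y)%:E + (v y `^ p y)%:E)))%E).
  apply: le_integral_conull => //.
  - exact: regular_points_conull.
  - move=> y [Qy [[Dy Wy] py]]; rewrite -EFinD -EFinM lee_fin.
    have -> : dot (W x *m w) (f y) =
        dot (invmx (W y) *m (W x *m w)) (W y *m f y).
      by rewrite dot_mulmx symW// mulKVmx.
    apply: (le_trans (cauchy_schwarz _ _)).
    apply: (@le_trans _ _ (l * m * r * (u y * v y))).
      rewrite /u /v le_eqVlt; apply/orP; left; apply/eqP; field.
      by apply/and3P; split; lra.
    by rewrite ler_wpM2l// young_powR.
  - apply: measurable_funeM; apply: emeasurable_funD; exact/measurable_EFinP.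
rewrite ge0_integralZl_EFin//; last 2 first.
- by move=> y _; rewrite -EFinD lee_fin addr_ge0 ?powR_ge0.
- by apply: emeasurable_funD; exact/measurable_EFinP.
rewrite ge0_integralD//; last 4 first.
- by move=> y _; rewrite lee_fin powR_ge0.
- exact/measurable_EFinP.
- by move=> y _; rewrite lee_fin powR_ge0.
- exact/measurable_EFinP.
rewrite (_ : 2 * l * m * r = (l * m * r) * (1 + 1)); last by ring.
rewrite (EFinM (l * m * r)) EFinD lee_pmul2l ?lte_fin ?mulr_gt0//.
apply: leeD.
  apply: le_trans modl; apply: ge0_le_integral_lower => //.
  - by move=> y _; rewrite lee_fin powR_ge0.
  - by move=> y _; exact: poweR_ge0.
  move=> y [Qy Gy]; rewrite /opW modular_integrandE ?mulr_ge0 ?op_norm_ge0// lee_fin.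
  rewrite indicE mem_set// mulr1.
  have r0' : 0 <= conj_exponent p y.
    by rewrite (le_trans ler01)// regular_conj_exponent_ge1.
  have uy : u y <= op_norm (invmx (W y) *m W x) / l.
    rewrite /u invfM mulrA ler_pM2r ?invr_gt0// ler_pdivrMr// mulmxA.
    by rewrite (le_trans (eucl_norm_le_op_norm _ _))// ler_wpM2l// op_norm_ge0.
  by apply: ge0_ler_powR => //; rewrite nnegrE// (le_trans (u0 y)).
apply: le_trans modm; apply: ge0_le_integral_lower => //.
- by move=> y _; rewrite lee_fin powR_ge0.
- by move=> y _; exact: poweR_ge0.
by move=> y [Qy Gy]; rewrite modular_integrandE// eucl_norm_ge0.
Qed.

Lemma integrable_coord (x : T) (f : T -> 'cV[R]_d) (l m : R) :
  (forall i, measurable_fun D (fun x => f x i 0)) ->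
  W x \in unitmx -> 0 < l -> 0 < m ->
  (modular mu D (conj_exponent p) (opW x) l <= 1)%E ->
  (modular mu D p (fun y => (eucl_norm (W y *m f y))%:E) m <= 1)%E ->
  forall i, mu.-integrable Q (fun y => (f y i 0)%:E).
Proof.
move=> mf Wx l0 m0 modl modm i; apply/integrableP; split.
  by apply/measurable_EFinP; exact: (measurable_funS mD).
(* With this choice W(x) w = e_i. The bound |w| + 1 used next is positive even if w = 0. *)
pose w := invmx (W x) *m delta_mx i 0 : 'cV[R]_d.
have := @hoelder_weight x f w l m (eucl_norm w + 1) mf l0 m0.
rewrite lerDl ler01 => /(_ _ isT modl modm).
rewrite ltr_pwDr ?eucl_norm_ge0// => /(_ isT).
under eq_integral do rewrite /w mulmxA mulmxV// mul1mx dot_delta.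
by move/le_lt_trans; apply; rewrite ltry.
Qed.

Lemma dot_Rintegral (a : 'cV[R]_d) (f : T -> 'cV[R]_d) :
  (forall i, mu.-integrable Q (fun y => (f y i 0)%:E)) ->
  (dot a (\col_i \int[mu]_(y in Q) f y i 0))%:E =
  (\int[mu]_(y in Q) (dot a (f y))%:E)%E.
Proof.
move=> intf; rewrite /dot -sumEFin.
under [RHS]eq_integral do rewrite -sumEFin.
rewrite integral_sum//=; last first.
  by move=> i; under eq_fun do rewrite EFinM; exact: integrableZl.
apply: eq_bigr => i _; rewrite mxE EFinM /Rintegral fineK; last first.
  exact: integrable_fin_num.
by rewrite -integralZl//; apply: eq_integral => y _; rewrite EFinM.
Qed.

Lemma weighted_average_le (x : T) (f : T -> 'cV[R]_d) (l m : R) : D x ->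
  (forall i, measurable_fun D (fun x => f x i 0)) ->
  (forall i, mu.-integrable Q (fun y => (f y i 0)%:E)) ->
  0 < l -> 0 < m ->
  (modular mu D (conj_exponent p) (opW x) l <= 1)%E ->
  (modular mu D p (fun y => (eucl_norm (W y *m f y))%:E) m <= 1)%E ->
  eucl_norm (W x *m \col_i \int[mu]_(y in Q) f y i 0) <= 2 * l * m.
Proof.
move=> Dx mf intf l0 m0 modl modm; apply: eucl_norm_le_dual => w w1.
rewrite dot_mulmx symW// -lee_fin dot_Rintegral//.
have := hoelder_weight mf l0 m0 ltr01 w1 modl modm; rewrite mulr1.
apply: le_trans; apply: le_trans (lee_abs _) _; apply: le_abse_integral => //.
apply/measurable_EFinP; apply: measurable_dot => // i.
exact: (measurable_funS mD).
Qed.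


(** Pointwise on [Q], the weighted average is at most 2 c m N(x), where N(x) is the inner norm,
    possibly infinite. Division by 2 c l m leaves N(x) / l. *)
Lemma average_modular_le (q : T -> R) (f : T -> 'cV[R]_d) (c l m : R) :
  (forall x, D x -> 1 <= q x) ->
  (forall i, measurable_fun D (fun x => f x i 0)) ->
  (forall i, mu.-integrable Q (fun y => (f y i 0)%:E)) ->
  0 < c -> 0 < l -> 0 < m ->
  (modular mu D q (fun x =>
    Lvar_norm mu D (conj_exponent p) (opW x) * (\1_Q x)%:E) l <= 1)%E ->
  (modular mu D p (fun y => (eucl_norm (W y *m f y))%:E) m <= 1)%E ->
  (modular mu D q (fun x => (eucl_norm
    (W x *m (\1_Q x *: (c *: \col_i \int[mu]_(y in Q) f y i 0))))%:E)
    (2 * c * l * m) <= 1)%E.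
Proof.
move=> q1 mf intf c0 l0 m0 modl modm; apply: le_trans modl.
have clm0 : 0 < 2 * c * l * m by rewrite !mulr_gt0.
apply: ge0_le_integral_lower => // [x _|x _|x Dx]; try exact: poweR_ge0.
have N0 := Lvar_norm_ge0 mu D (conj_exponent p) (opW x).
set N := Lvar_norm _ _ _ _ in N0 *.
have q0 : 0 <= q x by rewrite (le_trans ler01)// q1.
apply: gt0_ler_poweR => //.
- by rewrite in_itv/= leey andbT mule_ge0// lee_fin invr_ge0 ltW.
- by rewrite in_itv/= leey andbT mule_ge0// lee_fin invr_ge0 ltW.
rewrite !gee0_abs ?lee_fin ?eucl_norm_ge0//; last by rewrite mule_ge0// lee_fin.
rewrite -EFinM indicE; case: (boolP (x \in Q)) => Qx; last first.
  by rewrite scale0r mulmx0 eucl_norm0 mul0r mule0 mul0e.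
rewrite mule1 -[true%:R]/(1 : R) scale1r -scalemxAr eucl_normZ (gtr0_norm c0).
rewrite lee_pdivlMr// -EFinM.
set z := eucl_norm _.
suff zN : (z%:E <= (2 * m)%:E * N)%E.
  rewrite (_ : c * z / _ * l = z / (2 * m)); last first.
    by field; rewrite !gt_eqF.
  by rewrite EFinM lee_pdivrMr ?mulr_gt0// muleC.
move: N0; case NE : N => [r| |]// r0; last by rewrite gt0_muley ?leey// lte_fin mulr_gt0.
rewrite -EFinM lee_fin; apply/ler_addgt0Pr => e e0.
(* The inner modular is controlled only strictly above N(x). This excess becomes [e] after
   multiplication by 2 m. *)
have rl : (N < (r + e / (2 * m))%:E)%E by rewrite NE lte_fin ltrDl !divr_gt0// mulr_gt0.
have re0 : 0 < r + e / (2 * m).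
  by rewrite ltr_wpDl ?divr_gt0 ?mulr_gt0// -lee_fin.
have mod1 := modular_gt_Lvar_norm conj_exponent_ge0 rl.
have := weighted_average_le Dx mf intf re0 m0 mod1 modm.
rewrite -/z (_ : 2 * _ * m = 2 * m * r + e)//.
by field; rewrite gt_eqF.
Qed.

(** Otherwise the integrand of the outer modular is [+oo] on a set of positive measure. A single
    such point suffices to apply [integrable_coord]. *)
Lemma opW_norm_finite_point (q : T -> R) (l : R) : (0 < mu Q)%E ->
  (forall x, D x -> 1 <= q x) -> 0 < l ->
  (modular mu D q (fun x =>
    Lvar_norm mu D (conj_exponent p) (opW x) * (\1_Q x)%:E) l <= 1)%E ->
  exists x, [/\ Q x, G x & (Lvar_norm mu D (conj_exponent p) (opW x) < +oo)%E].
Proof.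
move=> muQ0 q1 l0; apply: contraPP => /forallNP hn.
apply/negP; rewrite -ltNge.
apply: (@lt_le_trans _ _ (\int[mu]_(x in Q `&` G) +oo)%E).
  by rewrite integral_cst// gt0_mulye ?ltry// measure_regular_points.
apply: ge0_le_integral_lower => // [x _|x [Qx Gx]]; first exact: poweR_ge0.
have -> : Lvar_norm mu D (conj_exponent p) (opW x) = +oo%E.
  apply/eqP; rewrite -leye_eq leNgt; apply/negP => h.
  by apply: (hn x).
rewrite indicE mem_set// mule1 gee0_abs ?leey// gt0_mulye ?lte_fin ?invr_gt0//.
rewrite poweRyr// gt_eqF// (lt_le_trans ltr01)// q1//.
exact: regular_points_sub.
Qed.

Hypothesis muQ_fin : (mu Q < +oo)%E.

(** The unit ball is described by its modular at level 1, which implies norm at most 1 and is what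
    can be computed for the extremal functions. *)
Definition unit_ball_averages : set 'cV[R]_d := [set u | exists f : T -> 'cV[R]_d,
  [/\ forall i, measurable_fun D (fun x => f x i 0),
      (modular mu D p (fun y => (eucl_norm (W y *m f y))%:E) 1 <= 1)%E &
      u = \col_i \int[mu]_(y in Q) f y i 0]].
Local Notation K := unit_ball_averages.

Hypothesis K_integrable : forall f : T -> 'cV[R]_d,
  (forall i, measurable_fun D (fun x => f x i 0)) ->
  (modular mu D p (fun y => (eucl_norm (W y *m f y))%:E) 1 <= 1)%E ->
  forall i, mu.-integrable Q (fun y => (f y i 0)%:E).

(** * The norm conjugate formula *)

Section duality.
Variables (v : 'cV[R]_d) (M l : R).
Hypotheses (Ml : M < l) (l_gt0 : 0 < l).
Hypothesis K_le : forall u, K u -> `|dot v u| <= M.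

Let h y := eucl_norm (invmx (W y) *m v).
Let F y := (h y / l) `^ conj_exponent p y.

Let h_ge0 y : 0 <= h y. Proof. exact: eucl_norm_ge0. Qed.
Let F_ge0 y : 0 <= F y. Proof. exact: powR_ge0. Qed.

Let mh : measurable_fun (Q `&` G) h.
Proof. by apply: measurable_eucl_norm => i; exact: measurable_invW_mulmx. Qed.

Let mF : measurable_fun (Q `&` G) F.
Proof.
apply: measurable_fun_powR2; last exact: measurable_conj_exponent.
exact: measurable_funM.
Qed.

(** On this truncation [h] and the conjugate exponent are bounded, so [F] has a finite integral, by
    which the extremal function can be normalized. *)
Let E (k : nat) : set T :=
  Q `&` G `&` [set y | h y <= k%:R] `&` [set y | conj_exponent p y <= k%:R].

Let E_sub k : E k `<=` Q `&` G. Proof. by move=> y [[]]. Qed.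

Let mE k : measurable (E k).
Proof.
have -> : E k = (Q `&` G `&` h @^-1` `]-oo, k%:R]) `&`
    (Q `&` G `&` conj_exponent p @^-1` `]-oo, k%:R]).
  by apply/seteqP; split => x; rewrite /E/= !in_itv/=; tauto.
apply: measurableI; first by apply: mh => //; exact: measurable_itv.
by apply: measurable_conj_exponent => //; exact: measurable_itv.
Qed.

Let mFE k : measurable_fun (E k) F.
Proof. by apply: measurable_funS mF. Qed.

Let integral_E_fin k : (\int[mu]_(y in E k) (F y)%:E < +oo)%E.
Proof.
(* The base is at least 1, so the exponent may be raised to [k]. *)
pose B := 1 + k%:R / l.
have B1 : 1 <= B by rewrite lerDl divr_ge0// ltW.
apply: (@le_lt_trans _ _ (\int[mu]_(y in E k) (B `^ k%:R)%:E)%E).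
  apply: ge0_le_integral_lower => // [y _|y _|y [[[Qy Gy] hy] py]].
  - by rewrite lee_fin.
  - by rewrite lee_fin powR_ge0.
  rewrite lee_fin; apply: (@le_trans _ _ (B `^ conj_exponent p y)).
    have p'0 := regular_conj_exponent_ge1 Gy.
    apply: ge0_ler_powR; rewrite ?nnegrE.
    - by rewrite (le_trans ler01).
    - by rewrite divr_ge0// ltW.
    - by rewrite (le_trans ler01).
    - rewrite /B (le_trans (y := k%:R / l))//; last by rewrite lerDr.
      by rewrite ler_pM2r ?invr_gt0.
  exact: ler_powR.
rewrite integral_cst//; apply: lte_mul_pinfty => //; first by rewrite lee_fin powR_ge0.
apply: le_lt_trans muQ_fin; apply: le_measure; rewrite ?inE//.
by move=> x /E_sub[].
Qed.

(* The case of equality in Hoelder's inequality against [W^-1 v]. *)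
Let extremal k (s : R) (y : T) : 'cV[R]_d :=
  if y \in E k then ((h y / l) `^ (conj_exponent p y - 1) / s / h y) *:
    (invmx (W y) *m (invmx (W y) *m v)) else 0.

Let measurable_extremal k s i : measurable_fun D (fun x => extremal k s x i 0).
Proof.
pose phi y := ((h y / l) `^ (conj_exponent p y - 1) / s / h y) *
    (invmx (W y) *m (invmx (W y) *m v)) i 0.
rewrite (_ : (fun x => _) = phi \_ (E k)); last first.
  apply/funext => y; rewrite patchE /extremal; case: ifP => _; rewrite mxE//.
apply/(measurable_restrict _ _ _).1 => //.
rewrite setIidr; last by move=> y /E_sub/QG_sub.
apply: (measurable_funS mQG (@E_sub k)).
apply: measurable_funM; last first.
  apply: measurable_mulmx => [a b|a b]; last first.
    by rewrite ord1; exact: measurable_invW_mulmx.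
  apply: (measurable_funS (measurable_unitmx mD mW)); first by move=> x [_ []].
  exact: measurable_invmx.
apply: measurable_funM; last exact: measurable_fun_invr.
apply: measurable_funM => //; apply: measurable_fun_powR2.
  exact: measurable_funM.
by apply: measurable_funB => //; exact: measurable_conj_exponent.
Qed.

(** As (p' - 1) p = p', the p-th power of |W f| for the extremal f is at most s^-p F, and s^-p <=
    s^-1 because s >= 1. The integral of [F] is [s], so the modular is at most 1. *)
Let modular_extremal k s : 1 <= s ->
  (\int[mu]_(y in E k) (F y)%:E)%E = s%:E ->
  (modular mu D p (fun y => (eucl_norm (W y *m extremal k s y))%:E) 1 <= 1)%E.
Proof.
move=> s1 Is; have s0 : 0 < s by lra.
have -> : 1%E = (\int[mu]_(y in D) ((fun y => (s^-1)%:E * (F y)%:E) \_ (E k)) y)%E.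
  rewrite -integral_mkcondr setIidr; last by move=> y /E_sub/QG_sub.
  rewrite ge0_integralZl_EFin ?invr_ge0 ?(ltW s0)//.
  - by rewrite Is -EFinM mulVf// gt_eqF.
  - by move=> y _; rewrite lee_fin.
  - exact/measurable_EFinP.
apply: ge0_le_integral_lower => // [y _|y _|y Dy].
- exact: poweR_ge0.
- by apply: erestrict_ge0 => x _; rewrite -EFinM lee_fin mulr_ge0// invr_ge0 ltW.
rewrite modular_integrandE ?eucl_norm_ge0// patchE /extremal divr1.
case: ifPn => [|_]; last first.
  rewrite mulmx0 eucl_norm0 powR0//.
  by rewrite gt_eqF// (lt_le_trans ltr01)// p_ge1.
rewrite inE => /E_sub[Qy Gy]; rewrite -EFinM lee_fin.
have [[_ Wy] py'] := Gy; have py : 1 < p y := py'.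
set g := _ / s.
have g0 : 0 <= g by rewrite divr_ge0 ?powR_ge0// ltW.
apply: (@le_trans _ _ (g `^ p y)).
  apply: ge0_ler_powR; rewrite ?nnegrE ?eucl_norm_ge0//.
    by rewrite (le_trans ler01)// p_ge1.
  rewrite -scalemxAr mulKVmx// eucl_normZ ger0_norm; last first.
    by rewrite divr_ge0.
  rewrite -/(h y); have [->|hy0] := eqVneq (h y) 0; first by rewrite mulr0.
  by rewrite -mulrA mulVf// mulr1.
rewrite /g [leLHS]powRM ?powR_ge0 ?invr_ge0 ?(ltW s0)// mulrC -powRrM.
have -> : (conj_exponent p y - 1) * p y = conj_exponent p y.
  by rewrite /conj_exponent; field; lra.
apply: ler_pM; [exact: powR_ge0|exact: powR_ge0| |by rewrite /F].
rewrite -(powR_inv1 (ltW s0)) -powRrM mulN1r powRN powR_inv1 ?(ltW s0)//.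
by rewrite lef_pV2 ?posrE ?powR_gt0// le1r_powR// p_ge1.
Qed.

(** The integrand is (h/l)^(p'-1) h / s = (l/s) F, and [F] integrates to [s]. *)
Let dot_extremal k s : 1 <= s ->
  (\int[mu]_(y in E k) (F y)%:E)%E = s%:E ->
  (\int[mu]_(y in Q) (dot v (extremal k s y))%:E)%E = l%:E.
Proof.
move=> s1 Is; have s0 : 0 < s by lra.
transitivity (\int[mu]_(y in Q) ((fun y => (l / s)%:E * (F y)%:E) \_ (E k)) y)%E.
  apply: eq_integral => y _; rewrite patchE /extremal; case: ifPn => [|_]; last first.
    by rewrite -{1}(scale0r 0) dotZr mul0r.
  rewrite inE => /E_sub[Qy Gy]; rewrite dotZr dot_mulmx invW_sym; last exact: QD.
  rewrite -sqr_eucl_norm -/(h y) -EFinM; congr (_%:E).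
  have p'0 := lt_le_trans ltr01 (regular_conj_exponent_ge1 Gy).
  have t0 : 0 <= h y / l by rewrite divr_ge0// ltW.
  rewrite /F -(mulr_powRB1 t0 p'0).
  have [->|hy0] := eqVneq (h y) 0; first by rewrite !mul0r expr0n/= !mulr0.
  by field; rewrite hy0 !gt_eqF.
rewrite -integral_mkcondr setIidr; last by move=> y /E_sub[].
rewrite ge0_integralZl_EFin ?divr_ge0 ?(ltW s0) ?(ltW l_gt0)//.
- by rewrite Is -EFinM divfK// gt_eqF.
- by move=> y _; rewrite lee_fin.
- exact/measurable_EFinP.
Qed.

(** If the integral over some [E k] exceeded 1, the extremal function would give an element of [K]
    whose product with [v] is l > M. Monotone convergence in [k] then gives the whole integral. *)
Lemma norm_conjugate_le : (\int[mu]_(y in Q `&` G)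
  ((eucl_norm (invmx (W y) *m v) / l) `^ conj_exponent p y)%:E <= 1)%E.
Proof.
have EE : Q `&` G = \bigcup_k E k.
  apply/seteqP; split => [y QGy|y [k _ /E_sub//]].
  pose k := (Num.truncn (Num.max (h y) (conj_exponent p y))).+1.
  have hk : Num.max (h y) (conj_exponent p y) <= k%:R by rewrite ltW// truncnS_gt.
  by exists k => //; move: hk; rewrite ge_max => /andP[].
have step k : (\int[mu]_(y in E k) (F y)%:E <= 1)%E.
  rewrite leNgt; apply/negP => I1.
  pose s := fine (\int[mu]_(y in E k) (F y)%:E).
  have Is : (\int[mu]_(y in E k) (F y)%:E)%E = s%:E.
    rewrite fineK// ge0_fin_numE ?integral_E_fin// integral_ge0// => y _.
    by rewrite lee_fin.
  have s1 : 1 <= s by rewrite -lee_fin -Is ltW.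
  have mod1 := modular_extremal s1 Is.
  have mext := measurable_extremal k s.
  have Ku : K (\col_i \int[mu]_(y in Q) extremal k s y i 0).
    by exists (extremal k s); split.
  have := dot_Rintegral v (K_integrable mext mod1).
  rewrite (dot_extremal s1 Is) => -[vl].
  by have := K_le Ku; rewrite vl gtr0_norm// leNgt Ml.
rewrite EE.
have cvgI := @ge0_nondecreasing_set_cvg_integral _ _ _ E (EFin \o F) mu.
apply: (cvge_le _ (cvgI _ mE _ _)).
- by near=> k; exact: step.
- apply/nondecreasing_seqP => k; apply/subsetPset => y [[QGy hk] pk].
  by split; [split => //|]; rewrite /= (le_trans hk, le_trans pk)// ler_nat.
- by move=> k; apply/measurable_EFinP.
- by move=> k x _; rewrite lee_fin.
Unshelve. all: by end_near. Qed.

End duality.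

Hypothesis muQ_gt0 : (0 < mu Q)%E.

Let muQG : (0 < mu (Q `&` G) < +oo)%E.
Proof. by rewrite measure_regular_points muQ_gt0. Qed.

(** If [v] were orthogonal to [K], then [norm_conjugate_le] with M = 0 would hold at every level l >
    0, against [modular_lower_bound]. *)
Lemma unit_ball_averages_spanning (v : 'cV[R]_d) :
  v != 0 -> exists2 u, K u & dot v u != 0.
Proof.
move=> v0; apply: contrapT => hn.
have K_le u : K u -> `|dot v u| <= 0.
  move=> Ku; rewrite normr_le0; apply/negPn/negP => vu; apply: hn; by exists u.
have [||delta delta0 hdelta] :=
    @modular_lower_bound _ _ _ mu (Q `&` G) (fun y => eucl_norm (invmx (W y) *m v))
      mQG muQG.
- by apply: measurable_eucl_norm => i; exact: measurable_invW_mulmx.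
- move=> y [_ [[_ Wy] _]]; rewrite eucl_norm_gt0; apply: contraNneq v0 => Wv.
  by rewrite -(mulKVmx Wy v) Wv mulmx0.
have d2 : 0 < delta / 2 by lra.
suff : delta <= delta / 2 by lra.
apply: (hdelta _ (conj_exponent p) d2) => [y [_]|].
  exact: regular_conj_exponent_ge1.
exact: (norm_conjugate_le d2 d2 K_le).
Qed.

(** * From bounded averages to the iterated norm *)

Section lower_bound.
Variables (q : T -> R) (c l0 : R).
Hypothesis q_ge1 : forall x, D x -> 1 <= q x.
Hypothesis mq : measurable_fun D q.
Hypotheses (c_gt0 : 0 < c) (l0_gt0 : 0 < l0).
Hypothesis K_bound : forall u, K u ->
  (modular mu D q (fun x => (eucl_norm (W x *m (\1_Q x *: (c *: u))))%:E) l0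
    <= 1)%E.

(** |W(x) u| >= |u_i| / S(x), with S(x) built from the entries of W(x)^-1. A large u_i would thus
    make the modular in [K_bound] exceed 1. The value of [B] does not enter the final constant; it
    only makes the supremum of the determinants finite. *)
Lemma unit_ball_averages_bounded :
  exists B : R, forall u, K u -> forall i, `|u i 0| <= B.
Proof.
pose S x := 1 + \sum_i \sum_j `|invmx (W x) i j|.
have S0 x : 0 < S x.
  by rewrite ltr_pwDl// sumr_ge0// => i _; exact: sumr_ge0.
have S_ub x (u : 'cV[R]_d) i : W x \in unitmx ->
    `|u i 0| / S x <= eucl_norm (W x *m u).
  move=> Wx; rewrite ler_pdivrMr//.
  rewrite -{1}(mulKmx Wx u) mxE (le_trans (ler_norm_sum _ _ _))//.
  rewrite mulrC (@le_trans _ _ ((\sum_j `|invmx (W x) i j|) * eucl_norm (W x *m u)))//.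
    rewrite mulr_suml ler_sum// => j _; rewrite normrM ler_wpM2l//.
    exact: ler_coord_eucl_norm.
  rewrite ler_wpM2r ?eucl_norm_ge0// /S [X in 1 + X](bigD1 i)//= addrCA lerDl addr_ge0//.
  by rewrite sumr_ge0// => k _; exact: sumr_ge0.
have [||delta delta0 hdelta] :=
    @modular_lower_bound _ _ _ mu (Q `&` G) (fun x => (S x)^-1) mQG muQG.
- apply: measurable_fun_invr; apply: measurable_funD => //.
  apply: measurable_sum => i; apply: measurable_sum => j.
  apply: measurableT_comp => //.
  apply: (measurable_funS (measurable_unitmx mD mW)).
    by move=> x [_ []].
  exact: measurable_invmx.
- by move=> y _; rewrite invr_gt0.
exists (l0 / (c * delta)) => u Ku i.
have [->|ui0] := eqVneq (u i 0) 0.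
  by rewrite normr0 divr_ge0 ?mulr_ge0// ltW.
have ui : 0 < `|u i 0| by rewrite normr_gt0.
have lam0 : 0 < l0 / (c * `|u i 0|) by rewrite divr_gt0// mulr_gt0.
suff : delta <= l0 / (c * `|u i 0|).
  rewrite ler_pdivlMr ?mulr_gt0// mulrA => h.
  by rewrite ler_pdivlMr ?mulr_gt0// mulrC (mulrC c).
apply: (hdelta _ q lam0) => [x /QG_sub|]; first exact: q_ge1.
apply: le_trans (K_bound Ku); apply: ge0_le_integral_lower => //.
- by move=> x _; rewrite lee_fin powR_ge0.
- by move=> x _; exact: poweR_ge0.
move=> x [Qx [[Dx Wx] _]]; rewrite modular_integrandE ?eucl_norm_ge0// lee_fin.
rewrite indicE mem_set// scale1r -scalemxAr eucl_normZ (gtr0_norm c_gt0).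
have le1 : (S x)^-1 / (l0 / (c * `|u i 0|)) <= c * eucl_norm (W x *m u) / l0.
  rewrite invf_div mulrA ler_pM2r ?invr_gt0// mulrCA ler_pM2l// mulrC.
  exact: S_ub.
have ge0 : 0 <= (S x)^-1 / (l0 / (c * `|u i 0|)).
  by rewrite divr_ge0// ?invr_ge0 ltW.
apply: ge0_ler_powR; rewrite ?nnegrE//.
- by rewrite (le_trans ler01)// q_ge1.
- exact: le_trans ge0 le1.
Qed.

Hypothesis d_gt0 : (0 < d)%N.

(** For v the j-th column of the symmetric matrix W(x), <v, U_k> is the j-th coordinate of W(x) U_k.
    So [norm_conjugate_le] applies to each column with M = 2 s, and [powR_mean_le] combines the d
    modulars at the cost of d^2. *)
Lemma opW_norm_le (U : 'I_d -> 'cV[R]_d) x : D x ->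
  (forall u v, K u -> `|dot v u| <= 2 * \sum_j `|dot v (U j)|) ->
  (Lvar_norm mu D (conj_exponent p) (opW x) <=
   (2 * d%:R ^+ 2 * \sum_j eucl_norm (W x *m U j))%:E)%E.
Proof.
move=> Dx hU; set s := \sum_j _.
have s0 : 0 <= s by apply: sumr_ge0 => j _; exact: eucl_norm_ge0.
have d0 : 0 < d%:R :> R by rewrite ltr0n.
have d20 : 0 < d%:R ^+ 2 :> R by rewrite exprn_gt0.
apply/lee_addgt0Pr => e e0.
(* Slightly above 2 s, since [norm_conjugate_le] needs a strict inequality. *)
pose l := 2 * s + e / d%:R ^+ 2.
have sl : 2 * s < l by rewrite ltrDl divr_gt0.
have l_gt0 : 0 < l by apply: le_lt_trans sl; rewrite mulr_ge0.
rewrite -EFinD (_ : _ + e = d%:R ^+ 2 * l); last first.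
  by rewrite /l; field; rewrite gt_eqF.
apply: Lvar_norm_le; first by rewrite mulr_gt0.
pose h j y := eucl_norm (invmx (W y) *m col j (W x)).
have mh j : measurable_fun (Q `&` G) (fun y => (h j y / l) `^ conj_exponent p y).
  apply: measurable_fun_powR2; last exact: measurable_conj_exponent.
  apply: measurable_funM => //; apply: measurable_eucl_norm => i.
  exact: measurable_invW_mulmx.
pose g y := ((d%:R^-1)%:E * \sum_j ((h j y / l) `^ conj_exponent p y)%:E)%E.
have mg : measurable_fun (Q `&` G) g.
  apply: measurable_funeM; apply: emeasurable_sum => j.
  exact/measurable_EFinP.
have hj j : (\int[mu]_(y in Q `&` G) ((h j y / l) `^ conj_exponent p y)%:E <= 1)%E.
  apply: (@norm_conjugate_le _ (2 * s)) => // u Ku.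
  rewrite (le_trans (hU _ _ Ku))// ler_pM2l// ler_sum// => k _.
  have -> : dot (col j (W x)) (U k) = (W x *m U k) j 0.
    rewrite /dot mxE; apply: eq_bigr => i _; rewrite mxE; congr (_ * _).
    by rewrite -[in LHS](symW Dx) mxE.
  exact: ler_coord_eucl_norm.
apply: (@le_trans _ _ (\int[mu]_(y in G `&` Q) g y)%E); last first.
  rewrite setIC ge0_integralZl_EFin ?invr_ge0 ?(ltW d0)//; last 2 first.
  - by move=> y _; apply: sume_ge0 => j _; rewrite lee_fin powR_ge0.
  - by apply: emeasurable_sum => j; exact/measurable_EFinP.
  rewrite ge0_integral_sum//; last 2 first.
  - by move=> j; exact/measurable_EFinP.
  - by move=> j y _; rewrite lee_fin powR_ge0.
  rewrite muleC lee_pdivrMr// mul1e (le_trans (lee_sum _ (fun j _ => hj j)))//.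
  by rewrite sumEFin sumr_const card_ord.
rewrite integral_mkcondr; apply: (@le_integral_conull _ _ _ _ D G) => //.
- by move=> y; exact: regular_points_sub.
- by move=> y _; exact: poweR_ge0.
- move=> y Gy; rewrite patchE; have p'1 := regular_conj_exponent_ge1 Gy.
  rewrite /opW modular_integrandE ?mulr_ge0 ?op_norm_ge0//.
  rewrite indicE; case: ifPn => [|] Qy; last first.
    by rewrite mulr0 mul0r powR0// gt_eqF// (lt_le_trans ltr01 p'1).
  rewrite mulr1 /g sumEFin -EFinM lee_fin.
  apply: le_trans (powR_mean_le d_gt0 p'1 _); last first.
    by move=> j; rewrite divr_ge0 ?eucl_norm_ge0// ltW.
  have le1 : op_norm (invmx (W y) *m W x) / (d%:R ^+ 2 * l) <=
      (d%:R ^+ 2)^-1 * \sum_j h j y / l.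
    rewrite invfM mulrCA ler_pM2l ?invr_gt0// -mulr_suml ler_pM2r ?invr_gt0//.
    rewrite (le_trans (op_norm_le_sum _))// ler_sum// => j _.
    by rewrite /h !colE mulmxA.
  have ge0 : 0 <= op_norm (invmx (W y) *m W x) / (d%:R ^+ 2 * l).
    by rewrite divr_ge0 ?op_norm_ge0// mulr_ge0// ltW.
  apply: ge0_ler_powR; rewrite ?nnegrE//.
  + by rewrite (le_trans ler01).
  + exact: le_trans ge0 le1.
- by apply/(measurable_restrict _ _ _).1 => //; rewrite setIC.
Qed.

(** The functions [t j] come from d fixed elements of [K], so [K_bound] controls each of them. A
    second use of [powR_mean_le] turns 2 d^2 into 2 d^4. *)
Lemma Apq_norm_le : (c%:E * Lvar_norm mu D q (fun x =>
    Lvar_norm mu D (conj_exponent p) (opW x) * (\1_Q x)%:E) <=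
  (2 * d%:R ^+ 4 * l0)%:E)%E.
Proof.
have [B KB] := unit_ball_averages_bounded.
have [U KU hU] := exists_near_auerbach_basis KB unit_ball_averages_spanning.
have d0 : 0 < d%:R :> R by rewrite ltr0n.
have dn0 n : 0 < d%:R ^+ n :> R by rewrite exprn_gt0.
pose t j x := eucl_norm (W x *m (\1_Q x *: (c *: U j))) / l0.
have mt j : measurable_fun D (fun x => t j x `^ q x).
  apply: measurable_fun_powR2 => //; apply: measurable_funM => //.
  apply: measurable_eucl_norm => i; apply: measurable_W_mulmx => k.
  rewrite (_ : (fun x => _) = (fun x => \1_Q x * (c *: U j) k 0)).
    by apply: measurable_funM => //; exact: measurable_indic.
  by apply/funext => x; rewrite mxE.
rewrite muleC -lee_pdivlMr// -EFinM.
have L0 : 0 < 2 * d%:R ^+ 4 * l0 / c by rewrite divr_gt0// !mulr_gt0.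
apply: Lvar_norm_le => //.
apply: (@le_trans _ _ (\int[mu]_(x in D)
    ((d%:R^-1)%:E * \sum_j (t j x `^ q x)%:E))%E).
  apply: ge0_le_integral_lower => // [x _|x _|x Dx].
  - exact: poweR_ge0.
  - rewrite mule_ge0 ?lee_fin ?invr_ge0 ?(ltW d0)//.
    by apply: sume_ge0 => j _; rewrite lee_fin powR_ge0.
  have q0 : 0 <= q x by rewrite (le_trans ler01)// q_ge1.
  rewrite sumEFin -EFinM.
  apply: (@le_trans _ _ (((d%:R ^+ 2)^-1 * \sum_j t j x) `^ q x)%:E); last first.
    by rewrite lee_fin powR_mean_le ?q_ge1// => j; rewrite divr_ge0 ?eucl_norm_ge0 ?ltW.
  have N0 := Lvar_norm_ge0 mu D (conj_exponent p) (opW x).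
  rewrite -poweR_EFin; apply: gt0_ler_poweR => //.
  - by rewrite in_itv/= leey andbT mule_ge0// lee_fin invr_ge0 ltW.
  - rewrite in_itv/= leey andbT lee_fin mulr_ge0 ?invr_ge0 ?(ltW (dn0 _))//.
    by apply: sumr_ge0 => j _; rewrite divr_ge0 ?eucl_norm_ge0 ?ltW.
  rewrite gee0_abs; last by rewrite mule_ge0// lee_fin.
  rewrite lee_pdivrMr//.
  rewrite -EFinM /t indicE; case: (boolP (x \in Q)) => Qx; last first.
    rewrite mule0 lee_fin !mulr_ge0 ?invr_ge0 ?(ltW d0) ?(ltW l0_gt0) ?(ltW c_gt0)//.
    by apply: sumr_ge0 => j _; rewrite divr_ge0 ?eucl_norm_ge0 ?ltW.
  rewrite mule1 (le_trans (opW_norm_le Dx hU))// lee_fin.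
  rewrite [X in _ <= _ * X * _](eq_bigr (fun j =>
    c / l0 * eucl_norm (W x *m U j))); last first.
    move=> j _; rewrite -[true%:R]/(1 : R) scale1r -scalemxAr eucl_normZ.
    by rewrite (gtr0_norm c_gt0) mulrAC.
  rewrite -mulr_sumr le_eqVlt; apply/orP; left; apply/eqP.
  by field; rewrite !gt_eqF.
rewrite ge0_integralZl_EFin ?invr_ge0 ?(ltW d0)//; last 2 first.
- by move=> y _; apply: sume_ge0 => j _; rewrite lee_fin powR_ge0.
- by apply: emeasurable_sum => j; exact/measurable_EFinP.
rewrite ge0_integral_sum//; last 2 first.
- by move=> j; exact/measurable_EFinP.
- by move=> j y _; rewrite lee_fin powR_ge0.
have tj j : (\int[mu]_(x in D) (t j x `^ q x)%:E <= 1)%E.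
  apply: le_trans (K_bound (KU j)); apply: ge0_le_integral_lower => //.
  - by move=> x _; rewrite lee_fin powR_ge0.
  - by move=> x _; exact: poweR_ge0.
  by move=> x Dx; rewrite modular_integrandE// eucl_norm_ge0.
rewrite muleC lee_pdivrMr// mul1e (le_trans (lee_sum _ (fun j _ => tj j)))//.
by rewrite sumEFin sumr_const card_ord.
Qed.

End lower_bound.

End weighted_averages.

(** * Cubes *)

Lemma regular_points_ae (dT : measure_display) (T : measurableType dT)
    (R : realType) (d : nat) (mu : {measure set T -> \bar R}) (D : set T)
    (W : T -> 'M[R]_d) (p : T -> R) :
  measurable D -> (forall i j, measurable_fun D (fun x => W x i j)) ->
  measurable_fun D p -> {ae mu, forall x, D x -> pd_mx (W x)} ->
  (1%:E < ess_inf_in mu D p)%E -> mu (D `\` regular_points D W p) = 0%E.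
Proof.
move=> mD mW mp aeW /ereal_sup_gt[y aep y1].
have mG : measurable (D `\` regular_points D W p).
  by apply: measurableD => //; exact: measurable_regular_points.
apply/negligibleP => //.
have : {ae mu, forall x, D x -> regular_points D W p x}.
  apply: filterS2 aeW aep => x Wx px Dx; split; first split => //=.
    exact/pd_mx_unit/Wx.
  by rewrite /= -lte_fin (lt_le_trans y1)// px.
by apply: negligibleS => x [Dx nGx] /(_ Dx).
Qed.

(** Passage to the limit e -> 0; the 2 of Hoelder's inequality is relaxed to 4 on the way. *)
Lemma lee_limit_product (R : realType) (X N F : \bar R) (c A : R) : 0 < c ->
  (0 <= N)%E -> (N < +oo)%E -> (0 <= F)%E -> (F < +oo)%E ->
  (c%:E * N <= A%:E)%E ->
  (forall e, 0 < e -> (X <= (2 * c * (fine N + e) * (fine F + e))%:E)%E) ->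
  (X <= (4 * A)%:E * F)%E.
Proof.
case: N => [a| |]// c0; case: F => [b| |]//=; rewrite !lee_fin => a0 _ b0 _.
move=> ca key; have A0 : 0 <= A by rewrite (le_trans _ ca)// mulr_ge0// ltW.
apply: (@le_trans _ _ (2 * c * a * b)%:E); last first.
  rewrite -EFinM lee_fin ler_wpM2r// -mulrA.
  by apply: ler_pM => //; rewrite ?mulr_ge0 ?ler_nat// ltW.
apply/lee_addgt0Pr => e e0.
(* For e <= 1 the error 2 c e (a + b + e) is at most e s. *)
pose s := 2 * c * (a + b + 1).
have s0 : 0 < s by rewrite !mulr_gt0// ltr_wpDl// addr_ge0.
pose e' := Num.min 1 (e / s).
have e'0 : 0 < e' by rewrite lt_min ltr01 divr_gt0.
apply: (le_trans (key e' e'0)); rewrite -EFinD lee_fin.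
have e'1 : e' <= 1 by rewrite ge_min lexx.
have e's : e' * s <= e by rewrite -ler_pdivlMr// ge_min lexx orbT.
apply: (@le_trans _ _ (2 * c * a * b + e' * s)); last by rewrite lerD2l.
rewrite -subr_ge0 (_ : _ - _ = 2 * c * (e' * (1 - e'))); last by rewrite /s; ring.
by rewrite !mulr_ge0// ?subr_ge0// ltW.
Qed.

Section lebesgue_cubes.
Context {R : realType} {n d : nat}.
Local Notation L := (lebesgue_space R n).
Local Notation mu := (lebesgue_mu R n).
Variables (Omega Q : set 'rV[R]_n.+1) (p q : L -> R).
Variables (alpha : R) (W : L -> 'M[R]_d).
Hypothesis Omega_domain : domain Omega.
Hypothesis p_exponent : exponent mu Omega p.
Hypothesis q_exponent : exponent mu Omega q.
Hypothesis alpha_lt : alpha / n.+1%:R < 1.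
Hypothesis W_weight : matrix_weight Omega W.
Hypothesis W_invertible : invertible_weight Omega W.
Hypothesis Q_cube : cubes_in Omega Q.

Let mOmega : measurable (Omega : set L).
Proof. by case: Omega_domain => _ oO _; exact: open_lebesgue_measurable. Qed.

Let mQ : measurable (Q : set L).
Proof. by case: Q_cube => _ [a [l [_ ->]]]; exact: box_measurable. Qed.

Let Q_sub : Q `<=` Omega. Proof. by case: Q_cube. Qed.

Let muQ_fin : (mu Q < +oo)%E.
Proof. by case: Q_cube => _ [a [l [_ ->]]]; exact: lebesgue_box_lty. Qed.

Let mW i j : measurable_fun (Omega : set L) (fun x => W x i j).
Proof. by case: W_weight. Qed.

Let symW x : Omega x -> (W x)^T = W x.
Proof. by case: W_weight => h _ _ /h[]. Qed.

Let mp : measurable_fun (Omega : set L) p.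
Proof. by case: p_exponent. Qed.

Let mq : measurable_fun (Omega : set L) q.
Proof. by case: q_exponent. Qed.

Let p_ge1 x : Omega x -> 1 <= p x. Proof. by case: p_exponent => _ h _ _; exact: h. Qed.
Let q_ge1 x : Omega x -> 1 <= q x. Proof. by case: q_exponent => _ h _ _; exact: h. Qed.

Let G_conull :
  mu ((Omega : set L) `\` regular_points (Omega : set L) W p) = 0%E.
Proof. by case: p_exponent => _ _ h _; exact: regular_points_ae. Qed.

Definition Apq_term : \bar R := ((frac_coef alpha Q)%:E *
  Lvar_norm mu Omega q (fun x =>
    Lvar_norm mu Omega (conj_exponent p) (fun y =>
      (op_norm (invmx (W y) *m W x) * \1_Q y)%:E) * (\1_Q x)%:E))%E.

Let frac_coef0 : mu Q = 0%E -> frac_coef alpha Q = 0.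
Proof. by move=> Q0; rewrite /frac_coef Q0 /= powR0// subr_eq0 lt_eqF. Qed.

Let frac_coef_gt0 : (0 < mu Q)%E -> 0 < frac_coef alpha Q.
Proof. by move=> Q0; rewrite /frac_coef powR_gt0// fine_gt0// Q0. Qed.

Let frac_avg_coord (f : L -> 'cV[R]_d) i :
  measurable_fun (Omega : set L) (fun x => frac_avg alpha Q f x i 0).
Proof.
rewrite (_ : (fun x => _) = (fun x : L => \1_Q x *
    (frac_coef alpha Q *: \col_i \int[mu]_(y in Q) f y i 0) i 0)).
  by apply: measurable_funM => //; exact: measurable_indic.
by apply/funext => x; rewrite mxE.
Qed.

Lemma frac_avg_bound_of_Apq_term (A : R) :
  (Apq_term <= A%:E)%E -> frac_avg_bound Omega alpha p q W Q (4 * A).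
Proof.
move=> termA f [mf F_fin].
have A0 : 0 <= A.
  rewrite -lee_fin; apply: le_trans termA.
  by rewrite mule_ge0 ?lee_fin ?powR_ge0// Lvar_norm_ge0.
have F0 : (0 <= wLvar_norm mu Omega p W f)%E := Lvar_norm_ge0 _ _ _ _.
have [Q0|Q0] := eqVneq (mu Q) 0%E.
  have avg0 : frac_avg alpha Q f = fun=> 0.
    by apply/funext => x; rewrite /frac_avg frac_coef0// scale0r scaler0.
  have norm0 : wLvar_norm mu Omega q W (frac_avg alpha Q f) = 0%E.
    apply/eqP; rewrite eq_le Lvar_norm_ge0 andbT; apply/lee_addgt0Pr => e e0.
    rewrite add0e; apply: Lvar_norm_le => //.
    rewrite (_ : modular _ _ _ _ _ = 0%E) ?lee01//.
    apply: integral0_eq => x Ox; rewrite avg0 mulmx0 eucl_norm0 abse0 mul0e.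
    by rewrite poweR0r// gt_eqF// (lt_le_trans ltr01)// q_ge1.
  split; last by rewrite norm0 mule_ge0// lee_fin mulr_ge0.
  - move=> i; apply: (null_set_integrable mQ _ Q0); apply/measurable_EFinP.
    exact: (measurable_funS mOmega Q_sub (mf i)).
  - split; [exact: frac_avg_coord|by rewrite norm0].
have {}Q0 : (0 < mu Q)%E by rewrite lt_def Q0 measure_ge0.
have c0 := frac_coef_gt0 Q0; set c := frac_coef alpha Q in c0.
set N := Lvar_norm mu Omega q (fun x => Lvar_norm mu Omega (conj_exponent p)
  (opW (Q : set L) W x) * (\1_Q x)%:E)%E.
have cN : (c%:E * N <= A%:E)%E by exact: termA.
have N0 : (0 <= N)%E := Lvar_norm_ge0 _ _ _ _.
have N_fin : (N < +oo)%E.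
  rewrite ltey; apply/eqP => NE; move: cN; rewrite NE gt0_muley ?lte_fin//.
have [m [m0 modm _]] := Lvar_norm_lt F_fin.
have intf i : mu.-integrable (Q : set L) (fun y => (f y i 0)%:E).
  have [l [l0 modl _]] := Lvar_norm_lt N_fin.
  (* One point with finite inner norm makes every coordinate of [f] integrable over [Q]. *)
  have [x [Qx Gx Nx]] := opW_norm_finite_point mOmega mQ Q_sub mW mp G_conull
    Q0 q_ge1 l0 modl.
  have [l' [l'0 modl' _]] := Lvar_norm_lt Nx.
  have [[_ Wx] _] := Gx.
  exact: (integrable_coord mOmega mQ Q_sub mW symW mp G_conull mf Wx l'0 m0
    modl' modm).
have key : forall e, 0 < e -> (wLvar_norm mu Omega q W (frac_avg alpha Q f) <=
   (2 * c * (fine N + e) * (fine (wLvar_norm mu Omega p W f) + e))%:E)%E.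
  move=> e e0.
  have lN : (N < (fine N + e)%:E)%E.
    by rewrite EFinD fineK ?ge0_fin_numE// lteDl ?lte_fin// ge0_fin_numE.
  have lF : (wLvar_norm mu Omega p W f < (fine (wLvar_norm mu Omega p W f) + e)%:E)%E.
    by rewrite EFinD fineK ?lteDl ?lte_fin// ge0_fin_numE.
  have Ne0 : 0 < fine N + e by rewrite ltr_wpDl// fine_ge0.
  have Fe0 : 0 < fine (wLvar_norm mu Omega p W f) + e by rewrite ltr_wpDl// fine_ge0.
  have ge0_of_ge1 (r : L -> R) :
    (forall x, Omega x -> 1 <= r x) -> forall x, Omega x -> 0 <= r x.
    by move=> r1 x Ox; rewrite (le_trans ler01)// r1.
  have modN := @modular_gt_Lvar_norm _ _ _ mu Omega q _ _ (ge0_of_ge1 q q_ge1) lN.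
  have modF : (modular mu Omega p (fun y => (eucl_norm (W y *m f y))%:E)
      (fine (wLvar_norm mu Omega p W f) + e) <= 1)%E.
    exact: (@modular_gt_Lvar_norm _ _ _ mu Omega p _ _ (ge0_of_ge1 p p_ge1) lF).
  apply: Lvar_norm_le; first by rewrite !mulr_gt0.
  exact: (average_modular_le mOmega mQ Q_sub mW symW mp p_ge1 G_conull q_ge1
    mf intf c0 Ne0 Fe0 modN modF).
split; [exact: intf|split; [exact: frac_avg_coord|]|].
  by apply: le_lt_trans (key 1 ltr01) _; rewrite ltry.
exact: (lee_limit_product c0 N0 N_fin F0 F_fin cN key).
Qed.

Lemma Apq_term_le_of_bound (C : R) : (0 < d)%N -> 0 <= C ->
  frac_avg_bound Omega alpha p q W Q C ->
  (Apq_term <= (2 * d%:R ^+ 4 * C)%:E)%E.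
Proof.
move=> d0 C0 bound.
have d40 : 0 < 2 * d%:R ^+ 4 :> R by rewrite mulr_gt0// exprn_gt0// ltr0n.
have [Q0|Q0] := eqVneq (mu Q) 0%E.
  by rewrite /Apq_term frac_coef0// mul0e lee_fin mulr_ge0// ltW.
have {}Q0 : (0 < mu Q)%E by rewrite lt_def Q0 measure_ge0.
have c0 := frac_coef_gt0 Q0.
have wf (f : L -> 'cV[R]_d) :
    (forall i, measurable_fun (Omega : set L) (fun x => f x i 0)) ->
    (modular mu Omega p (fun y => (eucl_norm (W y *m f y))%:E) 1 <= 1)%E ->
    (wLvar_norm mu Omega p W f <= 1)%E.
  by move=> mf mod1; exact: Lvar_norm_le mod1.
apply/lee_addgt0Pr => e e0.
(* Strictly above [C], so that the weighted averages have modular at most 1 at this level; the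
   excess amounts to [e] in the conclusion. *)
pose l0 := C + e / (2 * d%:R ^+ 4).
have Cl : C < l0 by rewrite ltrDl divr_gt0.
rewrite -EFinD (_ : _ + e = 2 * d%:R ^+ 4 * l0); last first.
  by rewrite /l0 mulrDr [X in _ = _ + X]mulrC divfK// gt_eqF.
have l0_gt0 : 0 < l0 by exact: le_lt_trans Cl.
have wf_fin f mf mod1 : wLvar mu Omega p W f :=
  conj mf (le_lt_trans (wf f mf mod1) (ltry 1)).
apply: (Apq_norm_le mOmega mQ Q_sub mW symW mp p_ge1 G_conull muQ_fin _ Q0
  q_ge1 mq c0 l0_gt0 _ d0).
- by move=> f mf mod1; have [] := bound f (wf_fin f mf mod1).
- move=> u [f [mf mod1 ->]].
  have [_ _ h] := bound f (wf_fin f mf mod1).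
  apply: modular_gt_Lvar_norm => [x Ox|]; first by rewrite (le_trans ler01)// q_ge1.
  apply: le_lt_trans h _; apply: (@le_lt_trans _ _ C%:E); last by rewrite lte_fin.
  by rewrite -[leRHS]mule1 lee_wpmul2l ?lee_fin// wf.
Qed.

End lebesgue_cubes.
Theorem theorem3p1 (R : realType) (d : nat) (d_gt0 : (0 < d)%N) :
  exists Cd : R, 0 < Cd /\
  forall (n : nat) (Omega : set 'rV[R]_n.+1) (p q : lebesgue_space R n -> R)
    (alpha : R) (W : lebesgue_space R n -> 'M[R]_d),
  domain Omega ->
  exponent (lebesgue_mu R n) Omega p ->
  exponent (lebesgue_mu R n) Omega q ->
  0 < alpha / n.+1%:R < 1 ->
  (forall x, Omega x -> (p x)^-1 - (q x)^-1 = alpha / n.+1%:R) ->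
  matrix_weight Omega W ->
  invertible_weight Omega W ->
  ((exists C : R, 0 <= C /\
      forall Q, cubes_in Omega Q -> frac_avg_bound Omega alpha p q W Q C)
    <-> Apq Omega alpha p q W) /\
  (Cd^-1%:E * Apq_const Omega alpha p q W
     <= ereal_sup [set frac_avg_norm Omega alpha p q W Q | Q in cubes_in Omega]
     <= 4%:E * Apq_const Omega alpha p q W)%E.
Proof.
have d0 : 0 < d%:R :> R by rewrite ltr0n.
have Cd0 : 0 < 2 * d%:R ^+ 4 :> R by rewrite mulr_gt0// exprn_gt0.
exists (2 * d%:R ^+ 4); split => // n Omega p q alpha W dom pexp qexp.
move=> /andP[_ alpha1] _ wW iW.
have upper Q A : cubes_in Omega Q -> (Apq_term Omega Q p q alpha W <= A%:E)%E ->
    frac_avg_bound Omega alpha p q W Q (4 * A).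
  by move=> cQ; exact: frac_avg_bound_of_Apq_term.
have lower Q C : cubes_in Omega Q -> 0 <= C -> frac_avg_bound Omega alpha p q W Q C ->
    (Apq_term Omega Q p q alpha W <= (2 * d%:R ^+ 4 * C)%:E)%E.
  by move=> cQ; exact: Apq_term_le_of_bound.
have term_ge0 Q : (0 <= Apq_term Omega Q p q alpha W)%E.
  by rewrite mule_ge0 ?lee_fin ?powR_ge0// Lvar_norm_ge0.
have term_le Q : cubes_in Omega Q ->
    (Apq_term Omega Q p q alpha W <= Apq_const Omega alpha p q W)%E.
  by move=> cQ; apply: ereal_sup_ubound; exists Q.
split.
  split => [[C [C0 hC]]|Afin].
    apply: (@le_lt_trans _ _ (2 * d%:R ^+ 4 * C)%:E); last by rewrite ltry.
    by apply: ge_ereal_sup => _ [Q cQ <-]; exact: lower (hC _ cQ).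
  (* The maximum makes the constant nonnegative before any cube is at hand. *)
  pose A := Num.max 0 (fine (Apq_const Omega alpha p q W)).
  exists (4 * A); split; first by rewrite mulr_ge0// le_max lexx.
  move=> Q cQ; apply: upper => //; apply: le_trans (term_le _ cQ) _.
  have Afin' : Apq_const Omega alpha p q W \is a fin_num.
    by rewrite ge0_fin_numE// (le_trans (term_ge0 Q))// term_le.
  by rewrite -(fineK Afin') lee_fin le_max lexx orbT.
apply/andP; split.
  rewrite muleC lee_pdivrMr// muleC.
  apply: ge_ereal_sup => _ [Q cQ <-]; rewrite -[leLHS]/(Apq_term Omega Q p q alpha W).
  apply: (@le_trans _ _ ((2 * d%:R ^+ 4)%:E * frac_avg_norm Omega alpha p q W Q)%E).
    rewrite muleC -lee_pdivrMr//; apply: le_ereal_inf_tmp => _ [C [C0 hC] <-].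
    by rewrite lee_pdivrMr// -EFinM mulrC; exact: lower.
  by rewrite lee_pmul2l//; apply: ereal_sup_ubound; exists Q.
apply: ge_ereal_sup => _ [Q cQ <-].
apply: (@le_trans _ _ (4%:E * Apq_term Omega Q p q alpha W)%E); last first.
  by rewrite lee_pmul2l// term_le.
(* If the term is infinite, so is the right-hand side. Otherwise four times its real value is an
   admissible constant in the infimum that defines the operator norm. *)
have [tfin|] := ltP (Apq_term Omega Q p q alpha W) +oo%E; last first.
  by rewrite leye_eq => /eqP ->; rewrite gt0_muley ?leey// lte_fin.
have tE : Apq_term Omega Q p q alpha W = (fine (Apq_term Omega Q p q alpha W))%:E.
  by rewrite fineK// ge0_fin_numE.
rewrite tE -EFinM; apply: ereal_inf_lbound.
exists (4 * fine (Apq_term Omega Q p q alpha W)); last reflexivity.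
split; first by rewrite mulr_ge0// fine_ge0.
by apply: (upper _ _ cQ); rewrite -tE.
Qed.
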